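(* Let $t>0$ and suppose that conditions (A1) and (A2) of the context hold. Then $\nu_t$ is the semicircle distribution $\mathsf{sc}_t$ of variance $t$ if and only if $$t\ge t_{\mathrm{Wig}}:=\sup_{\alpha\in(0,1)}\exp\left(2\cdot\frac{g(\alpha)-g(1)}{1-\alpha}+\frac{\alpha}{1-\alpha}\log\alpha+1\right).$$ For $0<t<t_{\mathrm{Wig}}$, the distribution $\nu_t$ is not concentrated on the real line.
   Context: Let $P_n(z)=\sum_{k=0}^n\xi_k a_{k;n}z^k$ with: (A1) $\xi_0,\xi_1,\ldots$ are i.i.d. complex-valued, non-degenerate (not almost surely constant) random variables with $\mathbb{E}\log(1+|\xi_0|)<\infty$. (A2) $a_{k;n}$ ($n\in\mathbb{N}$, $0\le k\le n$) are deterministic complex coefficients such that for some continuous function $g:[0,1]\to\mathbb{R}$ one has $\lim_{n\to\infty}\sup_{0\le k\le n}\left|\frac1n\log|a_{k;n}|-g\left(\frac kn\right)\right|=0$; moreover $g$ is concave and its left derivative at $1$ satisfies $g'_-(1)>-\infty$. For $t\in\mathbb{C}\setminus\{0\}$, $\nu_t$ denotes the limit in probability (weak topology) of the empirical zero distributions (each zero, counted with multiplicity, gets weight $1/\deg$) of $\exp\{-\frac{t}{2n}\partial_z^2\}P_n$ as $n\to\infty$. It is the unique compactly supported probability measure on $\mathbb{C}$ with $\int\log|z-y|\,\nu_t(dy)=U_t(z)$ for all $z\in\mathbb{C}$, where $$U_t(z)=\sup_{\alpha\in[0,1]}f_t(\alpha,z)-g(1),\quad f_t(\alpha,z)=g(\alpha)+\alpha\log\sqrt{|t|\alpha}+\alpha\Psi\left(\frac{z}{\sqrt{t\alpha}}\right)\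 (\alpha\in(0,1]),\quad f_t(0,z)=g(0),$$ $$\Psi(z)=\frac14\operatorname{Re}\left(z^2-z\sqrt{z^2-4}\right)+\log\left|\frac{z+\sqrt{z^2-4}}{2}\right|-\frac12,$$ with $\sqrt{z^2-4}$ holomorphic on $\mathbb{C}\setminus[-2,2]$ and $\sim z$ at infinity (on $[-2,2]$ either sign gives the same value; $\Psi$ is even and continuous on $\mathbb{C}$). $\mathsf{sc}_t$ is the measure on $[-2\sqrt t,2\sqrt t]\subset\mathbb{R}$ with Lebesgue density $x\mapsto\sqrt{4t-x^2}/(2\pi t)$. *)

(* Defs.v *)
From HB Require Import structures.
From mathcomp Require Import all_boot all_order all_algebra.
From mathcomp Require Import complex.
From mathcomp Require Import all_classical all_reals all_analysis.

Set Implicit Arguments.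
Unset Strict Implicit.
Unset Printing Implicit Defensive.

Import Order.TTheory GRing.Theory Num.Theory.
Import numFieldNormedType.Exports.
Import ComplexField.

Local Open Scope classical_set_scope.
Local Open Scope complex_scope.
Local Open Scope ring_scope.

(* The complex plane [R[i]] with its usual topology and Borel sigma-algebra. *)
HB.instance Definition _ (R : rcfType) := NormedModule.copy R[i] R[i]^o.

HB.instance Definition _ (R : rcfType) :=
  @isMeasurable.Build (sigma_display (@open R[i])) R[i] <<s @open R[i] >>
    (@sigma_algebra0 _ setT (@open R[i]))
    (@sigma_algebraC _ (@open R[i]))
    (@sigma_algebra_bigcup _ setT (@open R[i])).

Definition mutually_independent (d d' : measure_display)
    (T : measurableType d) (T' : measurableType d') (R : realType)
    (P : probability T R) (X : nat -> {RV P >-> T'}) :=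
  forall (s : seq nat) (A : nat -> set T'), uniq s ->
    (forall k, measurable (A k)) ->
    P (\bigcap_(k in [set` s]) (X k @^-1` A k)) =
    (\prod_(k <- s) P (X k @^-1` A k))%E.

Definition identically_distributed (d d' : measure_display)
    (T : measurableType d) (T' : measurableType d') (R : realType)
    (P : probability T R) (X : nat -> {RV P >-> T'}) :=
  forall (k : nat) (A : set T'), measurable A ->
    distribution P (X k) A = distribution P (X 0%N) A.

Definition condition_A1 (R : realType) (d : measure_display)
    (T : measurableType d) (P : probability T R) (xi : nat -> {RV P >-> R[i]}) :=
  [/\ mutually_independent xi,
      identically_distributed xi,
      ~ (exists c : R[i], {ae P, forall w, xi 0%N w = c}) &
      ('E_P[fun w => ln (1 + Normc.normc (xi 0%N w))] < +oo)%E].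

(* [a n k] stands for the coefficient a_{k;n}.  The logarithm [lne] has value
   -oo at 0, so that a vanishing a_{k;n} (n > 0) makes the supremum +oo. *)
Definition condition_A2 (R : realType) (a : nat -> nat -> R[i]) (g : R -> R) :=
  [/\ {within `[0, 1], continuous g},
      ereal_sup [set `| (n%:R^-1)%:E * lne (Normc.normc (a n k))%:E
                        - (g (k%:R / n%:R))%:E |%E
                | k in [set k | (k <= n)%N]] @[n --> \oo] --> 0%E,
      convex_function (`[0, 1] : set (convex_lmodType R^o)) (fun x => - g x) &
      exists2 l : \bar R,
        ((g x - g 1) / (x - 1))%:E @[x --> 1^'-] --> l & (-oo < l)%E].

Definition random_poly (R : realType) (d : measure_display)
    (T : measurableType d) (P : probability T R) (xi : nat -> {RV P >-> R[i]})
    (a : nat -> nat -> R[i]) (n : nat) (w : T) : {poly R[i]} :=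
  \poly_(k < n.+1) (xi k w * a n k).

(* exp(s * d^2/dz^2) p; the exponential series stops since the derivatives of p
   of order at least [size p] vanish. *)
Definition exp_deriv2 (R : realType) (s : R[i]) (p : {poly R[i]}) :
    {poly R[i]} :=
  \sum_(j < size p) (s ^+ j / j`!%:R) *: p^`(j.*2).

Definition zeros (R : realType) (p : {poly R[i]}) : seq R[i] :=
  if p == 0 then [::] else sval (closed_field_poly_normal p).

(* The null measure if p has no zero or p = 0. *)
Definition zero_distribution (R : realType) (p : {poly R[i]}) :
    {measure set R[i] -> \bar R} :=
  mscale ((size (zeros p))%:R^-1)%:nng
    (msum (fun k => dirac (nth 0 (zeros p) k)) (size (zeros p))).

(* Convergence in probability, for the weak topology, of the random measures
   [mu n] to the deterministic measure [nu]. *)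
Definition cvg_weakly_in_probability (R : realType) (d : measure_display)
    (T : measurableType d) (P : probability T R)
    (mu : nat -> T -> {measure set R[i] -> \bar R})
    (nu : probability R[i] R) :=
  forall phi : R[i] -> R, continuous phi ->
    (exists M : R, forall z, `|phi z| <= M) ->
    forall eps : R, 0 < eps ->
    P [set w | eps < `| \int[mu n w]_z phi z - \int[nu]_z phi z | ]
      @[n --> \oo] --> 0%E.

(* The branch of sqrt(z^2 - 4) that is holomorphic off [-2, 2] and equivalent
   to z at infinity; [sqrtc] is the principal square root, whose jumps on
   ]-oo, -2[ cancel out in this product. *)
Definition sqrt_sqrB4 (R : realType) (z : R[i]) : R[i] :=
  sqrtc (z - 2) * sqrtc (z + 2).

Definition Psi (R : realType) (z : R[i]) : R :=
  4^-1 * complex.Re (z ^+ 2 - z * sqrt_sqrB4 z)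
  + ln (Normc.normc ((z + sqrt_sqrB4 z) / 2)) - 2^-1.

Definition f_ (R : realType) (g : R -> R) (t : R[i]) (alpha : R) (z : R[i]) : R :=
  if alpha == 0 then g 0
  else g alpha + alpha * ln (Num.sqrt (Normc.normc t * alpha))
       + alpha * Psi (z / sqrtc (t * alpha%:C)).

Definition U_ (R : realType) (g : R -> R) (t : R[i]) (z : R[i]) : \bar R :=
  (ereal_sup [set (f_ g t alpha z)%:E | alpha in `[0%R, 1%R]] - (g 1)%:E)%E.

Definition compactly_supported (R : realType) (nu : probability R[i] R) :=
  exists2 K : set R[i], compact K & nu (~` K) = 0%E.

Definition has_log_potential (R : realType) (nu : probability R[i] R)
    (U : R[i] -> \bar R) :=
  forall z : R[i], (\int[nu]_y lne (Normc.normc (z - y)%R)%:E = U z)%E.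

(* [nu] is the limiting zero distribution nu_t of exp(-(t/2n) d^2/dz^2) P_n,
   together with its description by the logarithmic potential U_t. *)
Definition is_nu (R : realType) (d : measure_display)
    (T : measurableType d) (P : probability T R) (xi : nat -> {RV P >-> R[i]})
    (a : nat -> nat -> R[i]) (g : R -> R) (t : R[i]) (nu : probability R[i] R) :=
  [/\ cvg_weakly_in_probability P
        (fun n w => zero_distribution
           (exp_deriv2 (- (t / (2 * n%:R))) (random_poly xi a n w))) nu,
      compactly_supported nu &
      has_log_potential nu (U_ g t)].

Definition semicircle (R : realType) (t : R) (A : set R) : \bar R :=
  (\int[lebesgue_measure]_(x in A `&` `[(- (2 * Num.sqrt t))%R, (2 * Num.sqrt t)%R])
     (Num.sqrt (4 * t - x ^+ 2) / (2 * pi * t))%:E)%E.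

Definition t_Wig (R : realType) (g : R -> R) : \bar R :=
  ereal_sup [set (expR (2 * ((g alpha - g 1) / (1 - alpha))
                        + alpha / (1 - alpha) * ln alpha + 1))%:E
            | alpha in `]0%R, 1%R[].

(* Main.v *)
Require Import Defs.
From HB Require Import structures.
From mathcomp Require Import all_boot all_order all_algebra.
From mathcomp Require Import complex.
From mathcomp Require Import all_classical all_reals all_analysis.
From mathcomp Require Import measurable_realfun ring lra.
Import Order.TTheory GRing.Theory Num.Theory.
Import numFieldNormedType.Exports.
Local Open Scope classical_set_scope.
Local Open Scope complex_scope.
Local Open Scope ring_scope.

(** Write s for the square root of t, and phi (x) = ln s + x^2 / (4 t) - 1/2 for
    the value at x in [-2 s, 2 s] of the logarithmic potential of the semicircle
    law.  The theorem follows from the values of U_t on the real line alone.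

    These values are controlled by the inequality Psi (u) <= u^2 / 4 - 1/2 for u
    real, which is an equality on [-2, 2] ([Psi_segment], [Psi_le_quadratic]).
    Thus f_t(al, x) is at most x^2 / (4 t) plus a constant depending on al, with
    equality for |x| <= 2 s sqrt al, and comparing f_t(al, .) with f_t(1, .)
    amounts to comparing them at 0; the condition t_Wig <= t says exactly that
    f_t(al, 0) <= f_t(1, 0) for all al in ]0, 1[.  So if t_Wig <= t then
    U_t = phi on [-2 s, 2 s] ([U_segment]); and if t < t_Wig then U_t >= phi on
    this segment, with U_t >= phi + e near 0 for some e > 0 ([U_ge_phi],
    [t_Wig_gt]).  In both cases the lower bound on the left derivative of g at 1
    makes al = 1 optimal far from the origin, where U_t is therefore the
    potential of the semicircle law ([U_outside]).

    Two facts on measures then conclude.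

    - The arcsine law of [-2 s, 2 s], the law of 2 s cos x for a uniform angle x,
      has a potential which is ln s on this segment and larger off it; moreover
      the arcsine mean of phi is ln s.  By Tonelli's theorem, the arcsine mean of
      the potential of a measure is the integral of the potential of the arcsine
      law under this measure.  Hence a measure whose potential is phi on the
      segment lives on the real line ([potential_concentrated_on_reals]), and a
      measure that lives on the segment cannot have a potential that is at least
      phi there and larger on an interval ([segment_potential_not_above]).

    - A compactly supported measure on the real line whose potential agrees far
      from the origin with that of the semicircle law is the semicircle law
      ([eq_semicircle]): expanding the logarithm in Chebyshev polynomials gives
      the moments, and polynomials approximating the indicator of a half-line
      give the distribution function.

    If t_Wig <= t then nu_t lives on the real line, so it is the semicircle law.
    If t < t_Wig and nu_t lived on the real line, it would be the semicircle law,
    hence live on the segment, where its potential is too large.  The same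
    contradiction shows that nu_t is not the semicircle law when t < t_Wig. *)

(** * The complex plane as a measurable space *)

Section complex_plane.
Context {R : realType}.
Implicit Types (z y : R[i]) (x a b : R).

Lemma normcE_Re_Im z :
  ComplexField.Normc.normc z = Num.sqrt (complex.Re z ^+ 2 + complex.Im z ^+ 2).
Proof. by case: z. Qed.

Lemma normc_real x : ComplexField.Normc.normc (x%:C : R[i]) = `|x|.
Proof. by rewrite normcE_Re_Im /= expr0n addr0 sqrtr_sqr. Qed.

Lemma norm_normc z : `|z| = (ComplexField.Normc.normc z)%:C.
Proof. by case: z. Qed.

Lemma Re_le_normc z : `|complex.Re z| <= ComplexField.Normc.normc z.
Proof.
rewrite normcE_Re_Im -sqrtr_sqr ler_sqrt ?lerDl ?sqr_ge0 ?addr_ge0 ?sqr_ge0//.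
Qed.

Lemma Im_le_normc z : `|complex.Im z| <= ComplexField.Normc.normc z.
Proof.
rewrite normcE_Re_Im -sqrtr_sqr ler_sqrt ?lerDr ?sqr_ge0 ?addr_ge0 ?sqr_ge0//.
Qed.

(** Neighbourhoods in the complex plane are balls of complex radius; this
    brings continuity back to an estimate between real numbers. *)
Lemma continuous_lipschitz_normc (f : R[i] -> R) :
  (forall z y, `|f z - f y| <= ComplexField.Normc.normc (z - y)) ->
  continuous f.
Proof.
move=> fL z; apply/(@cvgrPdist_lt _ R^o _ (nbhs z) (nbhs_filter z)) => e e0.
have e0' : 0 < e%:C :> R[i] by rewrite ltcR.
have := @cvgr_dist_lt _ (R[i] : normedModType R[i]) _ (nbhs z)
  (nbhs_filter z) id z cvg_id _ e0'.
apply: filterS => y; rewrite norm_normc ltcR; exact: le_lt_trans.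
Qed.

Lemma continuous_Re : continuous (@complex.Re R).
Proof.
apply: continuous_lipschitz_normc => z y.
by apply: le_trans (Re_le_normc _); case: z y => [? ?] [? ?].
Qed.

Lemma continuous_Im : continuous (@complex.Im R).
Proof.
apply: continuous_lipschitz_normc => z y.
by apply: le_trans (Im_le_normc _); case: z y => [? ?] [? ?].
Qed.

Lemma continuous_normc : continuous (@ComplexField.Normc.normc R).
Proof.
apply: continuous_lipschitz_normc => z y.
rewrite -lecR -norm_normc -normc_real -norm_normc rmorphB /= -!norm_normc.
exact: ler_dist_dist.
Qed.

Lemma continuous_real_complex : continuous (real_complex R : R -> R[i]).
Proof.
move=> x; apply/(@cvgrPdist_lt _ (R[i] : normedModType R[i])) => /= e e0.
have [eR e0'] : e = (complex.Re e)%:C /\ 0 < complex.Re e.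
  move: e0; rewrite ltcE => /andP[/eqP i0 ->]; split=> //.
  by case: e i0 => a b /= ->.
near=> y.
rewrite -rmorphB norm_normc normc_real eR ltcR.
near: y; apply: cvgr_dist_lt => //; exact: cvg_id.
Unshelve. all: by end_near. Qed.

Lemma measurable_continuous_complex (f : R[i] -> R) :
  continuous f -> measurable_fun setT f.
Proof.
move=> cf.
apply: (@measurability _ _ R[i] R setT f _ (RGenOpens.measurableE R)).
move=> _ [_ [a [b ->]] <-]; rewrite setTI.
apply: sub_sigma_algebra; apply: open_comp; last exact: interval_open.
by move=> z _; exact: cf.
Qed.

Lemma measurable_Re : measurable_fun setT (@complex.Re R).
Proof. by apply: measurable_continuous_complex; exact: continuous_Re. Qed.

Lemma measurable_Im : measurable_fun setT (@complex.Im R).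
Proof. by apply: measurable_continuous_complex; exact: continuous_Im. Qed.

Lemma measurable_real_complex :
  measurable_fun setT (real_complex R : R -> R[i]).
Proof.
apply: (@measurability _ _ R R[i] setT (real_complex R) (@open R[i])) => //.
move=> _ [U oU <-]; rewrite setTI; apply: open_measurable.
by apply: open_comp => // x _; exact: continuous_real_complex.
Qed.

Lemma compact_normc_bounded (K : set R[i]) : compact K ->
  exists M : R, forall z, K z -> ComplexField.Normc.normc z <= M.
Proof.
move=> cK.
have : compact [set ComplexField.Normc.normc x | x in K].
  apply: continuous_compact => //; apply: continuous_subspaceT.
  exact: continuous_normc.
move=> /compact_bounded [M [_ /(_ (M + 1))]].
rewrite ltrDl ltr01 => /(_ isT) h.
exists (M + 1) => z Kz; apply: le_trans (h _ _); last by exists z.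
exact: ler_norm.
Qed.

Lemma measurable_normc_gt (k : R) :
  measurable [set y : R[i] | k < ComplexField.Normc.normc y].
Proof.
have := measurable_continuous_complex _ continuous_normc.
move=> /(_ measurableT `]k, +oo[%classic (measurable_itv _)).
rewrite setTI; congr measurable.
by apply/seteqP; split => y /=; rewrite in_itv /= andbT.
Qed.

Lemma measurable_Im_neq0 :
  measurable [set y : R[i] | complex.Im y != 0].
Proof.
rewrite (_ : [set y | _] = setT `&` (@complex.Im R) @^-1` (~` [set 0])).
  by apply: measurable_Im => //; apply: measurableC.
by rewrite setTI; apply/seteqP; split => y /= /eqP.
Qed.

End complex_plane.

(** * The potential of the arcsine law *)

Section continuous_integrals.
Context {R : realType}.
Notation mu := (@lebesgue_measure R).
Implicit Types (f : R -> R) (a b c d : R).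

Lemma continuous_itv_integrable f a b : continuous f ->
  mu.-integrable `[a, b] (EFin \o f).
Proof.
move=> cf; apply: continuous_compact_integrable; first exact: segment_compact.
exact: continuous_subspaceT.
Qed.

Lemma Rintegral_affine f c d a b : 0 < c -> a <= b -> continuous f ->
  \int[mu]_(x in `[(c * a + d)%R, (c * b + d)%R]) f x =
  c * \int[mu]_(x in `[a, b]) f (c * x + d).
Proof.
move=> c0 ab cf.
pose F x := c * x + d.
have dF x : is_derive x (1 : R) F c.
  rewrite (_ : F = c *: (@id R) + cst d)//.
  by apply: is_derive_eq; rewrite addr0 /GRing.scale /= mulr1.
have F' : F^`()%classic = cst c.
  by apply/funext => x; rewrite derive1E; apply: derive_val.
have cF : continuous F by move=> x; apply: differentiable_continuous;
  apply/derivable1_diffP; apply: ex_derive.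
rewrite [LHS]/Rintegral.
rewrite (@integration_by_substitution_increasing R F f a b) //=.
- rewrite F' /= -RintegralZl //=; last first.
    by apply: continuous_itv_integrable => x; apply: continuous_comp;
      [exact: cF | exact: cf].
  by congr fine; apply: eq_integral => x _ /=; rewrite mulrC.
- by move=> x y _ _ xy; rewrite /F ltrD2r ltr_pM2l.
- by rewrite F' => x _; exact: cvg_cst.
- by rewrite F'; exact: is_cvg_cst.
- by rewrite F'; exact: is_cvg_cst.
- split => //.
  + by apply: cvg_at_right_filter; exact: cF.
  + by apply: cvg_at_left_filter; exact: cF.
- exact: continuous_subspaceT.
Qed.

Lemma Rintegral_itv_cat f a b c : a <= b -> b <= c -> continuous f ->
  \int[mu]_(x in `[a, c]) f x =
  \int[mu]_(x in `[a, b]) f x + \int[mu]_(x in `[b, c]) f x.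
Proof.
move=> ab bc cf; apply/esym/eqP; rewrite addrC eq_sym -subr_eq; apply/eqP.
rewrite Rintegral_itvB ?bnd_simp//; last exact: continuous_itv_integrable.
rewrite Rintegral_itv_obnd_cbnd//.
apply: integrableS (continuous_itv_integrable f b c cf) => //.
exact: subset_itv_oc_cc.
Qed.

End continuous_integrals.

Section arcsine_potential.
Context {R : realType}.
Notation mu := (@lebesgue_measure R).
Implicit Types a b e x : R.

(** Points Y of the complex plane are given by their coordinates: Y = a + i b. *)
Definition sqdist a b x : R := (2 * cos x - a) ^+ 2 + b ^+ 2.

(** 4 pi times the logarithmic potential at a + i b of the arcsine law of
    [-2, 2].  It is computed below from the invariance of this law under
    Y -> Y^2 - 2, whose filled Julia set is [-2, 2]. *)
Definition log_mean a b : R :=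
  \int[mu]_(x in `[0%R, 2 * pi]) ln (sqdist a b x).

(** The level sets are the ellipses with foci -2 and 2; the value is
    |w| + 1/|w| when a + i b = w + 1/w, and 2 is the value on [-2, 2]. *)
Definition focal a b : R :=
  (Num.sqrt ((a - 2) ^+ 2 + b ^+ 2) + Num.sqrt ((a + 2) ^+ 2 + b ^+ 2)) / 2.

Lemma sqr_focal a b : focal a b ^+ 2 =
  (a ^+ 2 + b ^+ 2 + 4
   + Num.sqrt (((a - 2) ^+ 2 + b ^+ 2) * ((a + 2) ^+ 2 + b ^+ 2))) / 2.
Proof.
rewrite /focal sqrtrM ?addr_ge0 ?sqr_ge0//.
have h1 := sqr_sqrtr (addr_ge0 (sqr_ge0 (a + 2)) (sqr_ge0 b)).
have h2 := sqr_sqrtr (addr_ge0 (sqr_ge0 (a - 2)) (sqr_ge0 b)).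
rewrite expr_div_n sqrrD h1 h2; by field.
Qed.

(** The map Y -> Y^2 - 2 sends w + 1/w to w^2 + 1/w^2: it sends ellipses
    with foci -2 and 2 to such ellipses, squaring |w|. *)
Lemma focal_double a b :
  focal (a ^+ 2 - b ^+ 2 - 2) (2 * a * b) = focal a b ^+ 2 - 2.
Proof.
rewrite sqr_focal /focal.
rewrite (_ : _ + (2 * a * b) ^+ 2 =
  ((a - 2) ^+ 2 + b ^+ 2) * ((a + 2) ^+ 2 + b ^+ 2)); last by ring.
rewrite (_ : _ + (2 * a * b) ^+ 2 = (a ^+ 2 + b ^+ 2) ^+ 2); last by ring.
rewrite sqrtr_sqr ger0_norm ?addr_ge0 ?sqr_ge0//; by field.
Qed.

Lemma sqr_focal_le a b : focal a b ^+ 2 <= a ^+ 2 + b ^+ 2 + 4.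
Proof.
have ab0 : 0 <= a ^+ 2 + b ^+ 2 + 4 by rewrite !addr_ge0 ?sqr_ge0.
rewrite sqr_focal ler_pdivrMr//.
have : Num.sqrt (((a - 2) ^+ 2 + b ^+ 2) * ((a + 2) ^+ 2 + b ^+ 2)) <=
    a ^+ 2 + b ^+ 2 + 4.
  rewrite -[leRHS]ger0_norm// -sqrtr_sqr ler_sqrt ?sqr_ge0//.
  rewrite -subr_ge0 (_ : _ - _ = (4 * a) ^+ 2) ?sqr_ge0//; ring.
lra.
Qed.

Lemma sqr_focal_ge a b : a ^+ 2 + b ^+ 2 <= focal a b ^+ 2.
Proof.
rewrite sqr_focal ler_pdivlMr//.
have : a ^+ 2 + b ^+ 2 - 4 <=
    Num.sqrt (((a - 2) ^+ 2 + b ^+ 2) * ((a + 2) ^+ 2 + b ^+ 2)).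
  apply: le_trans (ler_norm _) _; rewrite -sqrtr_sqr ler_sqrt.
    rewrite -subr_ge0 (_ : _ - _ = (4 * b) ^+ 2) ?sqr_ge0//; ring.
  by rewrite mulr_ge0// addr_ge0 ?sqr_ge0.
lra.
Qed.

Lemma focal_ge0 a b : 0 <= focal a b.
Proof. by rewrite /focal divr_ge0// addr_ge0// sqrtr_ge0. Qed.

Lemma sqdist_gt0 a b x : 2 < focal a b -> 0 < sqdist a b x.
Proof.
move=> ab; rewrite lt_def addr_ge0 ?sqr_ge0// andbT.
apply/negP; rewrite paddr_eq0 ?sqr_ge0// !sqrf_eq0 subr_eq0.
move=> /andP[/eqP aE /eqP b0]; move: ab.
rewrite /focal b0 expr0n !addr0 !sqrtr_sqr -aE.
have := cos_geN1 x; have := cos_le1 x => h1 h2.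
rewrite ler0_norm; last by lra.
rewrite ger0_norm; last by lra.
lra.
Qed.

Lemma focal_gt2 a b : b != 0 -> 2 < focal a b.
Proof.
move=> b0; have bb : 0 < b ^+ 2 by rewrite exprn_even_gt0.
have lt_sqrt c : `|c| < Num.sqrt (c ^+ 2 + b ^+ 2).
  by rewrite -sqrtr_sqr ltr_sqrt ?ltrDl// ltr_pwDr ?sqr_ge0.
have := lt_sqrt (a - 2); have := lt_sqrt (a + 2).
rewrite /focal; have := ler_norm (a + 2); have := ler_norm (- (a - 2)).
rewrite normrN; lra.
Qed.

Lemma focal_itv_le a b : `|a| <= 2 -> 0 <= b -> focal a b <= 2 + b.
Proof.
rewrite ler_norml => /andP[a1 a2] b0; rewrite /focal.
have sqrt_le c : 0 <= c -> Num.sqrt (c ^+ 2 + b ^+ 2) <= c + b.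
  move=> c0; rewrite -[leRHS]ger0_norm ?addr_ge0// -sqrtr_sqr.
  rewrite ler_sqrt ?sqr_ge0// sqrrD -subr_ge0.
  by rewrite (_ : _ - _ = c * b *+ 2) ?mulrn_wge0 ?mulr_ge0//; ring.
have := sqrt_le (2 - a); have := sqrt_le (a + 2).
rewrite -[(2 - a) ^+ 2]sqrrN opprB; lra.
Qed.

Lemma continuous_sqdist a b : continuous (sqdist a b).
Proof.
move=> x; apply: cvgD; last exact: cvg_cst.
apply: (@continuous_comp _ _ _ (fun x => 2 * cos x - a) (fun y => y ^+ 2)).
  apply: cvgB; last exact: cvg_cst.
  by apply: cvgM; [exact: cvg_cst | exact: continuous_cos].
exact: exprn_continuous.
Qed.

Lemma continuous_ln_sqdist a b : 2 < focal a b ->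
  continuous (fun x => ln (sqdist a b x)).
Proof.
move=> ab x; apply: continuous_comp; first exact: continuous_sqdist.
by apply: continuous_ln; exact: sqdist_gt0.
Qed.

(** |Y - 2 cos x| |Y + 2 cos x| = |Y^2 - 2 - 2 cos (2 x)|. *)
Lemma sqdist_double a b x : sqdist a b x * sqdist a b (x + pi) =
  sqdist (a ^+ 2 - b ^+ 2 - 2) (2 * a * b) (2 * x).
Proof.
rewrite /sqdist cosDpi.
have -> : cos (2 * x) = cos x ^+ 2 * 2 - 1.
  by rewrite mulr_natl cos_mulr2n mulr_natr.
ring.
Qed.

(** Adding the values of the integrand at x and at x + pi turns Y into
    Y^2 - 2 and x into 2 x. *)
Lemma log_mean_double a b : 2 < focal a b ->
  log_mean a b = 2^-1 * log_mean (a ^+ 2 - b ^+ 2 - 2) (2 * a * b).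
Proof.
move=> ab; have pi0 := pi_ge0 R.
have ab' : 2 < focal (a ^+ 2 - b ^+ 2 - 2) (2 * a * b).
  by rewrite focal_double; nra.
have cf := continuous_ln_sqdist a b ab.
have cf' := continuous_ln_sqdist _ _ ab'.
have := Rintegral_affine (fun x => ln (sqdist a b x)) 1 pi 0 pi ltr01 pi0 cf.
rewrite mulr0 add0r !mul1r -mulr2n -(mulr_natl pi) => shift.
have := Rintegral_affine _ 2 0 0 pi (ltr0Sn _ 1) pi0 cf'.
rewrite mulr0 !addr0 => scale.
rewrite /log_mean (Rintegral_itv_cat _ _ pi)//; last by lra.
rewrite shift scale mulKf// -RintegralD//=; last 2 first.
- exact: continuous_itv_integrable.
- apply: continuous_itv_integrable => x.
  apply: (@continuous_comp _ _ _ (fun x => 1 * x + pi)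
    (fun x => ln (sqdist a b x))); last exact: cf.
  by apply: cvgD; [apply: cvgM; [exact: cvg_cst|exact: cvg_id] | exact: cvg_cst].
apply: eq_Rintegral => x _.
by rewrite mul1r addr0 -sqdist_double lnM// posrE sqdist_gt0.
Qed.

Lemma log_mean_le a b M : 2 < focal a b -> focal a b + 2 <= M ->
  log_mean a b <= 2 * pi * (2 * ln M).
Proof.
move=> ab abM; have pi0 := pi_ge0 R; have M0 : 0 < M by lra.
have e0 := focal_ge0 a b.
rewrite [leRHS](_ : _ = \int[mu]_(x in `[0%R, 2 * pi]) (2 * ln M)); last first.
  rewrite Rintegral_cst//= lebesgue_measure_itv /= lte_fin.
  by rewrite mulr_gt0 ?pi_gt0// -EFinB /= subr0 mulrC.
apply: le_Rintegral => //.
- by apply: continuous_itv_integrable; exact: continuous_ln_sqdist.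
- by apply: continuous_itv_integrable => x; exact: cvg_cst.
move=> x _; rewrite mulr_natl -lnXn// ler_ln ?posrE ?exprn_gt0 ?sqdist_gt0//.
apply: (@le_trans _ _ ((focal a b + 2) ^+ 2)); last first.
  by rewrite lerXn2r// nnegrE; lra.
have := sqr_focal_ge a b; rewrite /sqdist.
have := cos_geN1 x; have := cos_le1 x => h1 h2 h3.
have ae : `|a| <= focal a b.
  rewrite -ler_sqr ?nnegrE// real_normK ?num_real//.
  by apply: le_trans h3; rewrite lerDl sqr_ge0.
move: ae; rewrite ler_norml => /andP[a1 a2].
have p1 : 0 <= (1 + cos x) * (focal a b + a) by apply: mulr_ge0; lra.
have p2 : 0 <= (1 - cos x) * (focal a b - a) by apply: mulr_ge0; lra.
nra.
Qed.

Lemma log_mean_gt0_large a b : 4 <= focal a b -> 0 < log_mean a b.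
Proof.
move=> ab; have pi0 := pi_gt0 R; have ab2 : 2 < focal a b by lra.
have h := sqr_focal_le a b.
have ln_ge x : ln 2 <= ln (sqdist a b x).
  rewrite ler_ln ?posrE ?sqdist_gt0// /sqdist.
  have := cos_geN1 x; have := cos_le1 x => h1 h2.
  have := sqr_ge0 (a - 4 * cos x); have := sqr_ge0 b; nra.
apply: (@lt_le_trans _ _ (\int[mu]_(x in `[0%R, 2 * pi]) ln 2)).
  rewrite Rintegral_cst//= lebesgue_measure_itv /= lte_fin.
  have pi2 : 0 < 2 * pi :> R by rewrite mulr_gt0.
  by rewrite pi2 -EFinB /= subr0 !mulr_gt0 ?ln_gt0 ?ltr1n.
apply: le_Rintegral => //.
- by apply: continuous_itv_integrable => x; exact: cvg_cst.
- by apply: continuous_itv_integrable; exact: continuous_ln_sqdist.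
Qed.

(** Off [-2, 2] the orbit of Y under Y -> Y^2 - 2 escapes, since each step
    multiplies [focal - 2] by at least 4; once Y is at distance more than 1 from
    the segment the integrand is positive. *)
Lemma log_mean_gt0 a b : 2 < focal a b -> 0 < log_mean a b.
Proof.
move=> ab.
have [n] : exists n, 2 / 4 ^+ n <= focal a b - 2.
  have : 2 / 4 ^+ n @[n --> \oo] --> (0 : R).
    rewrite -(mulr0 2); apply: cvgMr.
    under eq_fun do rewrite -exprVn.
    by apply: cvg_expr; rewrite ger0_norm; lra.
  move=> /cvgr_le/(_ _ (_ : 0 < focal a b - 2))[|n _ /(_ n (leqnn n))].
    by rewrite subr_gt0.
  by exists n.
elim: n => [|n ih] in a b ab *.
  by rewrite expr0 => abn; apply: log_mean_gt0_large; lra.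
move=> abn; rewrite log_mean_double// mulr_gt0//.
have pos : 0 < 2 / 4 ^+ n :> R by rewrite divr_gt0// exprn_gt0.
have e4 : 2 / 4 ^+ n.+1 = (2 / 4 ^+ n) / 4 :> R.
  by rewrite exprSr invfM mulrA.
rewrite e4 in abn.
apply: ih; rewrite focal_double; nra.
Qed.

(** Near the segment a step multiplies [focal - 2] by at most 5, so that the
    integral can be halved n times before Y gets away from the segment. *)
Lemma log_mean_near_le n a b : 2 < focal a b -> focal a b - 2 <= (5 ^+ n)^-1 ->
  log_mean a b <= (2 ^+ n)^-1 * (2 * pi * (2 * ln 5)).
Proof.
elim: n => [|n ih] in a b *.
  rewrite !expr0 !invr1 mul1r => ab abn; apply: log_mean_le => //; lra.
move=> ab abn; rewrite log_mean_double// (exprS 2 n) invfM -[leRHS]mulrA ler_pM2l//.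
have p0 : 0 < (5 ^+ n)^-1 :> R by rewrite invr_gt0 exprn_gt0.
have p1 : (5 ^+ n)^-1 <= 1 :> R.
  by rewrite invf_le1 ?exprn_gt0// exprn_ege1// ler1n.
have e5 : (5 ^+ n.+1)^-1 = (5 ^+ n)^-1 / 5 :> R by rewrite exprSr invfM.
rewrite e5 in abn.
apply: ih; rewrite focal_double; nra.
Qed.

(** The limit of the mean at a point of [-2, 2], approached vertically, is at
    most 0. *)
Lemma log_mean_itv_le a (e : R) : `|a| <= 2 -> 0 < e ->
  exists2 b, 0 < b <= 1 & log_mean a b <= e.
Proof.
move=> a2 e0; pose M : R := 2 * pi * (2 * ln 5).
have [n hn] : exists n, (2 ^+ n)^-1 * M <= e.
  have : (2 ^+ n)^-1 * M @[n --> \oo] --> (0 : R).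
    rewrite -(mul0r M); apply: cvgMl.
    under eq_fun do rewrite -exprVn.
    by apply: cvg_expr; rewrite ger0_norm; lra.
  move=> /cvgr_le/(_ _ e0)[n _ /(_ n (leqnn n))].
  by exists n.
have b0 : 0 < (5 ^+ n)^-1 :> R by rewrite invr_gt0 exprn_gt0.
exists (5 ^+ n)^-1.
  by rewrite b0 invf_le1 ?exprn_gt0// exprn_ege1// ler1n.
apply: le_trans hn.
apply: log_mean_near_le; first by apply: focal_gt2; rewrite gt_eqF.
by rewrite lerBlDl; apply: focal_itv_le => //; exact: ltW.
Qed.

End arcsine_potential.

(** * Capped logarithms and their arcsine means *)

Section arcsine_energy.
Context {R : realType}.
Notation mu := (@lebesgue_measure R).
Implicit Types (a b c s x : R) (y : R[i]).

Lemma measurable_lne_EFin : measurable_fun setT (fun x : R => lne x%:E).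
Proof.
rewrite /lne; apply: measurable_fun_ifT => //=.
- by apply: measurable_fun_ler => //; exact: measurable_id.
- by apply/measurable_EFinP; exact: measurable_ln.
Qed.

Lemma ln_sqrt x : 0 < x -> ln (Num.sqrt x) = 2^-1 * ln x.
Proof.
move=> x0; rewrite -{2}[x]sqr_sqrtr ?ltW// lnXn ?sqrtr_gt0//.
by rewrite -(mulr_natl (ln _)) mulKf ?pnatr_eq0.
Qed.

Definition dist_xy a b x : R := Num.sqrt ((x - a) ^+ 2 + b ^+ 2).

(** The opposite of the logarithm of the distance from the real point x to
    a + i b, shifted by c and truncated at 0.  It is nonnegative, which gives
    access to Tonelli's theorem and monotone convergence in spite of the
    singularity, and the truncation is invisible at distance at most exp c. *)
Definition capped_log c a b x : \bar R := maxe 0%E (c%:E - lne (dist_xy a b x)%:E)%E.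

Lemma capped_log_ge0 c a b x : (0 <= capped_log c a b x)%E.
Proof. by rewrite /capped_log le_max lexx. Qed.

Lemma dist_xy_ge0 a b x : 0 <= dist_xy a b x.
Proof. exact: sqrtr_ge0. Qed.

Lemma dist_xy_le a b x : dist_xy a b x <= `|x| + Num.sqrt (a ^+ 2 + b ^+ 2).
Proof.
have := le_normcD (x%:C) (Complex (- a) (- b)).
by rewrite normc_real !normcE_Re_Im /= add0r !sqrrN.
Qed.

Lemma le_lne_EFin a b : 0 <= a -> a <= b -> (lne a%:E <= lne b%:E)%E.
Proof.
by move=> a0 ab; rewrite lee_lne ?in_itv//= ?leey ?lee_fin ?andbT// (le_trans a0).
Qed.

(** Moving a + i b away from the real axis increases its distance to all the
    real points. *)
Lemma capped_log_anti c a b b' x : `|b| <= `|b'| ->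
  (capped_log c a b' x <= capped_log c a b x)%E.
Proof.
move=> bb; rewrite /capped_log ge_max le_max lexx /= le_max; apply/orP; right.
apply: leeB => //; apply: le_lne_EFin; first exact: dist_xy_ge0.
by rewrite ler_sqrt ?addr_ge0 ?sqr_ge0// lerD2l -real_normK ?num_real//
  -[leRHS]real_normK ?num_real// lerXn2r ?nnegrE.
Qed.

Lemma measurable_capped_log c d (T : measurableType d) (fa fb fx : T -> R) :
  measurable_fun setT fa -> measurable_fun setT fb -> measurable_fun setT fx ->
  measurable_fun setT (fun w => capped_log c (fa w) (fb w) (fx w)).
Proof.
move=> mfa mfb mfx; apply: measurable_maxe => //.
apply: emeasurable_funB => //.
apply: (measurableT_comp measurable_lne_EFin).
rewrite /dist_xy.
have msqrt : measurable_fun setT (Num.sqrt : R -> R).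
  by apply: continuous_measurable_fun; exact: sqrt_continuous.
apply: (measurableT_comp msqrt).
apply: measurable_funD; apply: measurable_funX => //.
exact: measurable_funB.
Qed.


Lemma dist_xy_scale s a b x : 0 < s ->
  dist_xy a b (2 * s * cos x) = s * Num.sqrt (sqdist (a / s) (b / s) x).
Proof.
move=> s0; have s_neq0 : s != 0 by rewrite gt_eqF.
rewrite -[X in X * Num.sqrt _]gtr0_norm// -sqrtr_sqr -sqrtrM ?sqr_ge0//.
by rewrite /dist_xy /sqdist; congr Num.sqrt; field.
Qed.

Lemma pi2_gt0 : 0 < 2 * pi :> R.
Proof. by rewrite mulr_gt0 ?pi_gt0. Qed.

(* For a uniform angle x the point 2 s cos x follows the arcsine law of
   [-2 s, 2 s]. *)
Local Notation unif := (uniform_prob pi2_gt0).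

Lemma measurable_capped_log_cos c s a b :
  measurable_fun setT (fun x => capped_log c a b (2 * s * cos x)).
Proof.
apply: measurable_capped_log => //.
apply: continuous_measurable_fun => x.
by apply: cvgM; [exact: cvg_cst | exact: continuous_cos].
Qed.

Lemma capped_log_mean c s a b : 0 < s -> 2 < focal (a / s) (b / s) ->
  2 * s + Num.sqrt (a ^+ 2 + b ^+ 2) <= expR c ->
  (\int[unif]_x capped_log c a b (2 * s * cos x) =
  (c - ln s - log_mean (a / s) (b / s) / (4 * pi))%:E)%E.
Proof.
move=> s0 ab cE; rewrite integral_uniform; last 2 first.
- exact: measurable_capped_log_cos.
- by move=> x; exact: capped_log_ge0.
rewrite subr0; have pi0 := pi_gt0 R.
rewrite [X in (_ * X)%E](_ : _ = \int[mu]_(x in `[0%R, (2 * pi)%R])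
    (c - ln s - 2^-1 * ln (sqdist (a / s) (b / s) x))%:E)%E; last first.
  apply: eq_integral => x _; have q0 := sqdist_gt0 _ _ x ab.
  have d0 : 0 < dist_xy a b (2 * s * cos x).
    by rewrite dist_xy_scale// mulr_gt0// sqrtr_gt0.
  have dc : ln (dist_xy a b (2 * s * cos x)) <= c.
    rewrite -[leRHS]expRK ler_ln ?posrE ?expR_gt0//.
    apply: le_trans (dist_xy_le _ _ _) _; apply: le_trans cE.
    rewrite lerD2r normrM gtr0_norm ?mulr_gt0//.
    by rewrite ger_pMr ?mulr_gt0// ler_norml cos_geN1 cos_le1.
  rewrite /capped_log lne_EFin// -EFinB maxEle lee_fin subr_ge0 dc; congr EFin.
  rewrite dist_xy_scale// lnM ?posrE ?sqrtr_gt0//.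
  by rewrite ln_sqrt//; ring.
have cf : continuous (fun x => 2^-1 * ln (sqdist (a / s) (b / s) x)).
  by move=> x; apply: cvgM; [exact: cvg_cst | exact: continuous_ln_sqdist].
have ci : continuous (fun _ : R => c - ln s) by move=> x; exact: cvg_cst.
have e : (\int[mu]_(x in `[0%R, (2 * pi)%R])
     (c - ln s - 2^-1 * ln (sqdist (a / s) (b / s) x))%:E)%E =
   (\int[mu]_(x in `[0%R, (2 * pi)%R])
     (c - ln s - 2^-1 * ln (sqdist (a / s) (b / s) x)))%:E.
  rewrite /Rintegral fineK//; apply: integrable_fin_num => //.
  apply: continuous_itv_integrable => x; apply: cvgB; [exact: ci|exact: cf].
rewrite e RintegralB//; last 2 first.
- exact: continuous_itv_integrable.
- exact: continuous_itv_integrable.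
rewrite RintegralZl//; last first.
  by apply: continuous_itv_integrable; exact: continuous_ln_sqdist.
rewrite Rintegral_cst//= lebesgue_measure_itv /= lte_fin pi2_gt0.
rewrite -EFinB /= subr0 -EFinM -/(log_mean _ _); congr EFin.
move: (log_mean _ _) (lt0r_neq0 pi0) => J; move: (@pi R) => p p0.
by field.
Qed.


Lemma sqrt_sum_sqr_le a b : Num.sqrt (a ^+ 2 + b ^+ 2) <= `|a| + `|b|.
Proof.
by have := dist_xy_le 0 b a; rewrite /dist_xy subr0 expr0n add0r sqrtr_sqr.
Qed.

Lemma dist_xy_le_real a b x : dist_xy a b x <= dist_xy a 0 x + `|b|.
Proof.
rewrite {2}/dist_xy expr0n addr0 sqrtr_sqr; exact: sqrt_sum_sqr_le.
Qed.

(** A real a is the limit of a + i / (n + 1), where the mean is known; along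
    this sequence the capped logarithm increases to its value at a, including at
    its singularity. *)
Lemma capped_log_mean_real_le c s a : 0 < s -> 4 * s + `|a| + 1 <= expR c ->
  (\int[unif]_x capped_log c a 0 (2 * s * cos x) <= (c - ln s)%:E)%E.
Proof.
move=> s0 cE.
pose g n x := capped_log c a n.+1%:R^-1 (2 * s * cos x).
have g0 n x : (0 <= g n x)%E by exact: capped_log_ge0.
have mg n : measurable_fun setT (g n) by exact: measurable_capped_log_cos.
have ndg x : {homo g ^~ x : n m / (n <= m)%N >-> (n <= m)%E}.
  move=> n m nm; apply: capped_log_anti.
  by rewrite !ger0_norm// lef_pV2 ?posrE// ler_nat.
have gle n : (\int[unif]_x g n x <= (c - ln s)%:E)%E.
  have foc : 2 < focal (a / s) (n.+1%:R^-1 / s).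
    by apply: focal_gt2; rewrite mulf_neq0 ?invr_neq0 ?gt_eqF.
  rewrite capped_log_mean//.
    rewrite lee_fin gerBl divr_ge0 ?mulr_ge0 ?pi_ge0// ltW//.
    exact: log_mean_gt0.
  apply: le_trans cE; apply: le_trans (lerD (lexx _) (sqrt_sum_sqr_le _ _)) _.
  rewrite [`|_^-1|]ger0_norm//.
  have : n.+1%:R^-1 <= 1 :> R by rewrite invf_le1 ?ler1n.
  move: (n.+1%:R^-1) => v v1; lra.
have cvg_int := @cvg_monotone_convergence _ _ R unif _ measurableT _ mg
  (fun n x _ => g0 n x) (fun x _ => ndg x).
apply: (@le_trans _ _ (\int[unif]_x limn (g ^~ x))%E); last first.
  rewrite -(cvg_lim _ cvg_int)//; apply: lime_le.
    by apply/cvg_ex; eexists; exact: cvg_int.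
  by near=> n; exact: gle.
have cvg_g x : cvgn (g ^~ x) by apply: ereal_nondecreasing_is_cvgn; exact: ndg.
have lim_ge x n : (g n x <= limn (g ^~ x))%E.
  by apply: lime_ge => //; exists n => // m /= nm; exact: ndg.
apply: ge0_le_integral => //.
- by move=> x _; exact: capped_log_ge0.
- exact: measurable_capped_log_cos.
- apply: (emeasurable_fun_cvg g) => // x _; exact: cvg_g.
move=> x _; rewrite /capped_log ge_max; apply/andP; split.
  exact: le_trans (g0 0%N x) (lim_ge x 0%N).
set u := 2 * s * cos x.
(* Any level below the limit value, be it finite or not, is passed by some
   g n x. *)
have approx L : dist_xy a 0 u < expR L -> ((c - L)%:E <= limn (g ^~ x))%E.
  rewrite -subr_gt0 => dL.
  have [n _ /(_ n (leqnn n)) /= nL] := near_infty_natSinv_lt (PosNum dL).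
  apply: le_trans (lim_ge x n); rewrite /g /capped_log le_max; apply/orP; right.
  have dn := dist_xy_le_real a n.+1%:R^-1 u.
  rewrite EFinB; apply: leeB => //.
  rewrite -[L in leRHS]expRK -lne_EFin ?expR_gt0//.
  apply: le_lne_EFin; first exact: dist_xy_ge0.
  apply: le_trans dn _; rewrite ger0_norm//.
  by move: nL; move: (n.+1%:R^-1) => v nL; lra.
have [d0|d0] := leP (dist_xy a 0 u) 0.
  rewrite (_ : limn _ = +oo%E) ?leey//; apply: eq_infty => M.
  rewrite -[M](subKr c); apply: approx; exact: le_lt_trans d0 (expR_gt0 _).
rewrite lne_EFin// -EFinB; apply/lee_subgt0Pr => e e0.
rewrite -EFinB -addrA -opprD; apply: approx.
by rewrite expRD lnK// ltr_pMr// expR_gt1.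
Unshelve. all: by end_near. Qed.

(** The mean at a + i s b is a lower bound, and [log_mean_itv_le] provides a b
    for which it is at least c - ln s - e. *)
Lemma capped_log_mean_itv_ge c s a : 0 < s -> 4 * s + `|a| + 1 <= expR c ->
  `|a| <= 2 * s ->
  ((c - ln s)%:E <= \int[unif]_x capped_log c a 0 (2 * s * cos x))%E.
Proof.
move=> s0 cE as2; apply/lee_subgt0Pr => e e0.
have pi0 := pi_gt0 R.
have as2' : `|a / s| <= 2 by rewrite normrM [`|s^-1|]gtr0_norm ?invr_gt0// ler_pdivrMr.
have [|b /andP[b0 b1] be] := log_mean_itv_le _ (4 * pi * e) as2'.
  by rewrite !mulr_gt0.
apply: (@le_trans _ _ (\int[unif]_x capped_log c a (s * b) (2 * s * cos x))%E).
  have sb : s * b / s = b by rewrite mulrAC divff ?mul1r ?gt_eqF.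
  rewrite capped_log_mean ?sb//.
  - rewrite -EFinB lee_fin lerD2l lerN2 ler_pdivrMr ?mulr_gt0//.
    by rewrite [leRHS]mulrC.
  - by apply: focal_gt2; rewrite gt_eqF.
  - apply: le_trans cE; apply: le_trans (lerD (lexx _) (sqrt_sum_sqr_le _ _)) _.
    rewrite [`|s * b|]ger0_norm ?mulr_ge0 ?ltW//; nra.
apply: ge0_le_integral => //.
- by move=> x _; exact: capped_log_ge0.
- exact: measurable_capped_log_cos.
- exact: measurable_capped_log_cos.
by move=> x _; apply: capped_log_anti; rewrite normr0.
Qed.

End arcsine_energy.

(** * Averaging a logarithmic potential over the arcsine law *)

Section arcsine_averaging.
Context {R : realType}.
Notation mu := (@lebesgue_measure R).
Local Notation unif := (uniform_prob (@pi2_gt0 R)).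
Local Notation normc := (@ComplexField.Normc.normc R).
Variables (nu : probability R[i] R) (s k c : R).
Hypotheses (s0 : 0 < s) (c0 : 0 <= c) (nuk : nu [set y | k < normc y] = 0%E).

Let ball : set R[i] := ~` [set y | k < normc y].

Let measurable_ball : measurable ball.
Proof. by apply: measurableC; exact: measurable_normc_gt. Qed.

Let ballE y : ball y -> normc y <= k.
Proof. by rewrite /ball /= => /negP; rewrite -leNgt. Qed.

Let nu_ball : (nu : {measure set R[i] -> \bar R}) ball = 1%E.
Proof.
have := @probability_setC _ _ R nu _ (measurable_normc_gt k).
by rewrite nuk sube0.
Qed.

Lemma ge0_integral_ball (f : R[i] -> \bar R) : measurable_fun setT f ->
  (forall y, (0 <= f y)%E) -> (\int[nu]_y f y = \int[nu]_(y in ball) f y)%E.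
Proof.
move=> mf f0; rewrite (@ge0_negligible_integral _ _ _ nu setT _ _
  (measurable_normc_gt k))//.
by rewrite setTD.
Qed.

Lemma normc_dist_xy (x : R) y :
  normc (x%:C - y) = dist_xy (complex.Re y) (complex.Im y) x.
Proof.
by rewrite normcE_Re_Im; case: y => a b /=; rewrite add0r sqrrN.
Qed.

Lemma measurable_lne_normc (x : R) :
  measurable_fun setT (fun y : R[i] => lne (normc (x%:C - y))%:E).
Proof.
under eq_fun do rewrite normc_dist_xy.
apply: (measurableT_comp measurable_lne_EFin).
have msqrt : measurable_fun setT (Num.sqrt : R -> R).
  by apply: continuous_measurable_fun; exact: sqrt_continuous.
apply: (measurableT_comp msqrt).
apply: measurable_funD; apply: measurable_funX; last exact: measurable_Im.
by apply: measurable_funB => //; exact: measurable_Re.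
Qed.

Let capped x y := capped_log c (complex.Re y) (complex.Im y) x.

Let measurable_capped x : measurable_fun setT (capped x).
Proof.
by apply: measurable_capped_log; [exact: measurable_Re|exact: measurable_Im|].
Qed.

(** With f the logarithm in the right-hand side, the capped logarithm plus the
    positive part of f is c plus the negative part of f on the ball that carries
    [nu]; all four are nonnegative and the positive part of f is integrable.
    Both sides may be infinite. *)
Lemma capped_potential (x : R) : `|x| + k <= expR c ->
  (\int[nu]_y capped x y = c%:E - \int[nu]_y lne (normc (x%:C - y))%:E)%E.
Proof.
move=> xk.
pose f y := lne (normc (x%:C - y))%:E.
have mf : measurable_fun setT f.
  exact: measurable_lne_normc.
have fc y : ball y -> (f y <= c%:E)%E.
  move=> /ballE yk; rewrite /f -[c in leRHS]expRK -lne_EFin ?expR_gt0//.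
  rewrite normc_dist_xy; apply: le_lne_EFin; first exact: dist_xy_ge0.
  by apply: le_trans (dist_xy_le _ _ _) _; rewrite -normcE_Re_Im; lra.
have mfp : measurable_fun setT (f ^\+)%E by exact: measurable_funepos.
have mfn : measurable_fun setT (f ^\-)%E by exact: measurable_funeneg.
(* Pointwise, lne may be -oo; both sides are then +oo. *)
have split_fun y : ball y -> (c%:E + f^\- y = capped x y + f^\+ y)%E.
  move=> yb; have := fc y yb.
  rewrite /capped /capped_log -normc_dist_xy -/(f y) funeposE funenegE.
  case: (f y) => [r| |]//=.
  - rewrite lee_fin => rc; rewrite -!EFinB -!EFin_max -!EFinD; congr EFin.
    by rewrite /Order.max; do 3! case: ltP => ?; lra.
  - by rewrite ?maxNye ?maxye ?maxey ?addeNy ?addey //=.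
have fp_le : (\int[nu]_y (f ^\+)%E y <= c%:E)%E.
  rewrite ge0_integral_ball//; apply: (@le_trans _ _ (\int[nu]_(y in ball) c%:E)%E).
    apply: ge0_le_integral => //; first exact: measurable_funTS.
    by move=> y yb; rewrite funeposE ge_max lee_fin c0 fc.
  by rewrite integral_cst// nu_ball mule1.
have fp_fin : (\int[nu]_y (f ^\+)%E y)%E \is a fin_num.
  rewrite ge0_fin_numE ?(le_lt_trans fp_le) ?ltry//.
  by apply: integral_ge0 => y _; exact: funepos_ge0.
have : (c%:E + \int[nu]_y (f ^\-)%E y =
    \int[nu]_y capped x y + \int[nu]_y (f ^\+)%E y)%E.
  rewrite !ge0_integral_ball//; last first.
    by move=> y; exact: capped_log_ge0.
  rewrite -[X in (X + _)%E]mule1 -[X in (_ * X)%E]nu_ball -integral_cst//.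
  rewrite -!ge0_integralD//; last 4 first.
  - by move=> y _; exact: capped_log_ge0.
  - exact: measurable_funTS.
  - exact: measurable_funTS.
  - exact: measurable_funTS.
  by apply: eq_integral => y /set_mem yb; exact: split_fun.
rewrite -[X in _ -> _ = (_ - X)%E]/(\int[nu]_y f y)%E (integralE nu setT f).
move: fp_fin; move: (\int[nu]_y (f ^\+)%E y)%E => [p| |]// _.
have : (0 <= \int[nu]_y (f ^\-)%E y)%E by apply: integral_ge0.
move: (\int[nu]_y (f ^\-)%E y)%E => [n| |]//= _.
  move: (\int[nu]_y capped x y)%E => [h| |]//= [e].
  by rewrite -?EFinB -?EFinN -?EFinD; congr (_%:E); lra.
by move: (\int[nu]_y capped x y)%E => [h| |].
Qed.

Let kernel (w : R * R[i]) : \bar R := capped (2 * s * cos w.1) w.2.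

Let measurable_kernel : measurable_fun setT kernel.
Proof.
apply: measurable_capped_log.
- exact: (measurableT_comp measurable_Re).
- exact: (measurableT_comp measurable_Im).
have mcos : measurable_fun setT (fun x : R => 2 * s * cos x).
  apply: continuous_measurable_fun => x.
  by apply: cvgM; [exact: cvg_cst | exact: continuous_cos].
exact: (measurableT_comp mcos).
Qed.

Let kernel_ge0 w : (0 <= kernel w)%E.
Proof. exact: capped_log_ge0. Qed.

(** c minus the potential at y of the arcsine law of [-2 s, 2 s], for y in the
    ball and c large enough. *)
Definition arcsine_capped y : \bar R :=
  (\int[unif]_x capped (2 * s * cos x) y)%E.

Lemma measurable_arcsine_capped : measurable_fun setT arcsine_capped.
Proof.
exact: (measurable_fun_fubini_tonelli_G (m1 := unif) _ measurable_kernel kernel_ge0).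
Qed.

Lemma arcsine_capped_ge0 y : (0 <= arcsine_capped y)%E.
Proof. by apply: integral_ge0 => x _; exact: capped_log_ge0. Qed.

(** Tonelli's theorem: the mean of the potential of [nu] under the arcsine law
    is the integral under [nu] of the potential of the arcsine law; here both
    potentials are subtracted from c. *)
Lemma integral_arcsine_capped : (\int[nu]_y arcsine_capped y =
  (2 * pi)^-1%:E * \int[mu]_(x in `[0%R, (2 * pi)%R])
     \int[nu]_y capped (2 * s * cos x) y)%E.
Proof.
have := fubini_tonelli (m1 := unif) (m2 := nu) _ measurable_kernel kernel_ge0.
rewrite /kernel /= => <-.
rewrite integral_uniform ?subr0//.
  exact: (measurable_fun_fubini_tonelli_F (m2 := nu) _ measurable_kernel kernel_ge0).
by move=> x; apply: integral_ge0 => y _; exact: capped_log_ge0.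
Qed.

(** The potential on [-2 s, 2 s] of the semicircle law of variance s^2. *)
Let phi (x : R) : R := ln s + x ^+ 2 / (4 * s ^+ 2) - 2^-1.

Lemma continuous_phi_cos : continuous (fun x => c - phi (2 * s * cos x)).
Proof.
move=> x; apply: cvgB; first exact: cvg_cst.
apply: cvgB; last exact: cvg_cst.
apply: cvgD; first exact: cvg_cst.
apply: cvgM; last exact: cvg_cst.
apply: (@continuous_comp _ _ _ (fun x => 2 * s * cos x) (fun y => y ^+ 2)).
  by apply: cvgM; [exact: cvg_cst | exact: continuous_cos].
exact: exprn_continuous.
Qed.

(** The mean of [phi] under the arcsine law is ln s, the value of the potential
    of the arcsine law on its support. *)
Lemma integral_phi_cos :
  (\int[mu]_(x in `[0%R, (2 * pi)%R]) (c - phi (2 * s * cos x))%:E =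
   (2 * pi * (c - ln s))%:E)%E.
Proof.
pose F (x : R) := (c - ln s) * x - 2^-1 * (sin x * cos x).
have dF x : is_derive x (1 : R) F (c - phi (2 * s * cos x)).
  rewrite /F; apply: is_derive_eq.
  rewrite /GRing.scale /= mulr1 /phi -[sin x * _]mulrC.
  have := sin2cos2 x; rewrite !expr2 => e.
  have s_neq0 : s != 0 by rewrite gt_eqF.
  have -> : (2 * s * cos x) ^+ 2 / (4 * s ^+ 2) = cos x * cos x by field.
  lra.
rewrite (@continuous_FTC2 R (fun x => c - phi (2 * s * cos x)) F 0 (2 * pi) pi2_gt0).
- rewrite /F mulr_natl sin2pi mul0r !mulr0 sin0 mul0r mulr0 !subr0 -EFinB subr0.
  by rewrite mulrC.
- exact: continuous_subspaceT continuous_phi_cos.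
- split => [x _||]; first by apply: ex_derive.
  + apply: cvg_at_right_filter; apply: differentiable_continuous.
    by apply/derivable1_diffP; apply: ex_derive.
  + apply: cvg_at_left_filter; apply: differentiable_continuous.
    by apply/derivable1_diffP; apply: ex_derive.
- by move=> x _; rewrite derive1E; apply: derive_val.
Qed.

Hypothesis ck : 4 * s + k + 1 <= expR c.

Let cos_bound (x : R) : `|2 * s * cos x| <= 2 * s.
Proof.
rewrite normrM gtr0_norm ?mulr_gt0// ger_pMr ?mulr_gt0//.
by rewrite ler_norml cos_geN1 cos_le1.
Qed.

Let integral_measurable :
  measurable_fun setT (fun x : R => (\int[nu]_y capped (2 * s * cos x) y)%E).
Proof.
exact: (measurable_fun_fubini_tonelli_F (m2 := nu) _ measurable_kernel kernel_ge0).
Qed.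

Let arcsine_capped_le y : ball y -> (arcsine_capped y <= (c - ln s)%:E)%E.
Proof.
move=> /ballE yk; rewrite /arcsine_capped /capped.
have Rek : `|complex.Re y| <= k by apply: le_trans (Re_le_normc y) yk.
have [->|Im0] := eqVneq (complex.Im y) 0.
  by apply: capped_log_mean_real_le => //; apply: le_trans ck; lra.
have foc : 2 < focal (complex.Re y / s) (complex.Im y / s).
  by apply: focal_gt2; rewrite mulf_neq0// invr_neq0// gt_eqF.
rewrite capped_log_mean// -?normcE_Re_Im; last first.
  by apply: le_trans ck; move: s0; lra.
by rewrite lee_fin gerBl divr_ge0 ?mulr_ge0 ?pi_ge0// ltW// log_mean_gt0.
Qed.

Let arcsine_capped_lt y : ball y -> complex.Im y != 0 ->
  (arcsine_capped y < (c - ln s)%:E)%E.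
Proof.
move=> /ballE yk Im0; rewrite /arcsine_capped /capped.
have foc : 2 < focal (complex.Re y / s) (complex.Im y / s).
  by apply: focal_gt2; rewrite mulf_neq0// invr_neq0// gt_eqF.
rewrite capped_log_mean// -?normcE_Re_Im; last first.
  by apply: le_trans ck; move: s0; lra.
by rewrite lte_fin gtrBl divr_gt0 ?mulr_gt0 ?pi_gt0// log_mean_gt0.
Qed.

(** The potential of the arcsine law is at least ln s, strictly so off the real
    axis.  As its integral under [nu] is the arcsine mean of [phi], which is ln s,
    the part of [nu] off the real axis is null. *)
Lemma potential_concentrated_on_reals :
  (forall x : R, `|x| <= 2 * s ->
     (\int[nu]_y lne (normc (x%:C - y))%:E = (phi x)%:E)%E) ->
  nu [set y | complex.Im y != 0] = 0%E.
Proof.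
move=> pot.
have energy : (\int[nu]_y arcsine_capped y = (c - ln s)%:E)%E.
  rewrite integral_arcsine_capped.
  rewrite [X in (_ * X)%E](_ : _ = \int[mu]_(x in `[0%R, (2 * pi)%R])
    (c - phi (2 * s * cos x))%:E)%E; last first.
    apply: eq_integral => x _; rewrite capped_potential ?pot ?EFinB//.
    have := cos_bound x; have := ck; move: s0; lra.
  rewrite integral_phi_cos -EFinM mulKf// gt_eqF// pi2_gt0//.
pose gap y := maxe 0%E ((c - ln s)%:E - arcsine_capped y)%E.
have gap0 y : (0 <= gap y)%E by rewrite /gap le_max lexx.
have mgap : measurable_fun setT gap.
  apply: measurable_maxe => //; apply: emeasurable_funB => //.
  exact: measurable_arcsine_capped.
have gap_int : (\int[nu]_(y in ball) gap y = 0)%E.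
  have sum : (\int[nu]_(y in ball) arcsine_capped y
      + \int[nu]_(y in ball) gap y = (c - ln s)%:E)%E.
    rewrite -ge0_integralD//; last 3 first.
    - by move=> y _; exact: arcsine_capped_ge0.
    - exact: measurable_funTS measurable_arcsine_capped.
    - exact: measurable_funTS.
    rewrite (eq_integral (cst (c - ln s)%:E)).
      by rewrite integral_cst// nu_ball mule1.
    move=> y /set_mem yb; have := arcsine_capped_le y yb.
    have := arcsine_capped_ge0 y; rewrite /gap.
    case: (arcsine_capped y) => [r| |]//= r0 rc.
    rewrite max_r; first by rewrite -EFinB -EFinD; congr (_%:E); lra.
    by rewrite -EFinB lee_fin subr_ge0 -lee_fin.
  move: sum; rewrite -ge0_integral_ball; [|exact: measurable_arcsine_capped
    |exact: arcsine_capped_ge0].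
  rewrite energy; case: (\int[nu]_(y in ball) gap y)%E => [r| |]//= [e].
  by congr (_%:E); lra.
have ae_gap : ae_eq nu ball gap (cst 0%E).
  apply/ae_eq_integral_abs => //; first exact: measurable_funTS.
  by rewrite -[RHS]gap_int; apply: eq_integral => y _; rewrite gee0_abs.
apply: (@negligibleP _ _ _ nu _ measurable_Im_neq0).1.
have : nu.-negligible ([set y | k < normc y] `|`
    ~` [set y | ball y -> gap y = cst 0%E y]).
  apply: negligibleU; last exact: ae_gap.
  by apply/negligibleP => //; exact: measurable_normc_gt.
apply: negligibleS => y /= Im0.
have [ky|ky] := ltP k (normc y); [by left | right].
have yb : ball y by rewrite /ball /= => h; move: ky; rewrite leNgt h.
move=> /(_ yb); rewrite /gap /=.
have := arcsine_capped_lt y yb Im0; have := arcsine_capped_ge0 y.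
case: (arcsine_capped y) => [r| |]//= r0; rewrite lte_fin => rc.
rewrite max_r; last by rewrite lee_fin subr_ge0 ltW.
by case=> /eqP; rewrite subr_eq0 gt_eqF.
Qed.

Let arcsine_capped_ge y : complex.Im y = 0 -> `|complex.Re y| <= 2 * s ->
  ball y -> ((c - ln s)%:E <= arcsine_capped y)%E.
Proof.
move=> Im0 Re2 /ballE yk; rewrite /arcsine_capped /capped Im0.
have Rek : `|complex.Re y| <= k by apply: le_trans (Re_le_normc y) yk.
by apply: capped_log_mean_itv_ge => //; apply: le_trans ck; lra.
Qed.

(** On [-2 s, 2 s] the potential of the arcsine law is at most ln s, hence so is
    the arcsine mean of the potential of [nu].  A potential that is at least
    [phi] on the segment, and larger on an interval, has a larger mean. *)
Lemma segment_potential_not_above (r e : R) : 0 < r -> 0 < e ->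
  nu.-negligible (~` [set y | complex.Im y = 0 /\ `|complex.Re y| <= 2 * s]) ->
  (forall x : R, `|x| <= 2 * s ->
     ((phi x)%:E <= \int[nu]_y lne (normc (x%:C - y))%:E)%E) ->
  (forall x : R, `|x| <= 2 * s -> `|x| <= r ->
     ((phi x + e)%:E <= \int[nu]_y lne (normc (x%:C - y))%:E)%E) -> False.
Proof.
move=> r0 e0 nuseg pot pot_r.
have pi0 := pi_gt0 R.
have k0 : 0 <= k.
  rewrite leNgt; apply/negP => k_lt0; have : nu setT = 0%E.
    rewrite -nuk; congr (nu _); apply/seteqP; split => // y _ /=.
    by apply: lt_le_trans k_lt0 _; rewrite normcE_Re_Im sqrtr_ge0.
  by rewrite probability_setT => /eqP; rewrite onee_eq0.
have energy : ((c - ln s)%:E <= \int[nu]_y arcsine_capped y)%E.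
  rewrite ge0_integral_ball; [|exact: measurable_arcsine_capped
    |exact: arcsine_capped_ge0].
  rewrite -[leLHS]mule1 -nu_ball -integral_cst//.
  apply: ae_ge0_le_integral => //.
  - move=> y _; rewrite /= lee_fin subr_ge0 -[leRHS]expRK ler_ln ?posrE ?expR_gt0//.
    by apply: le_trans ck; move: s0 k0; lra.
  - by move=> y _; exact: arcsine_capped_ge0.
  - exact: measurable_funTS measurable_arcsine_capped.
  apply: negligibleS nuseg => y /= h [Im0 Re2]; apply: h => yb.
  exact: arcsine_capped_ge.
(* x = pi / 2 is an angle at which 2 s cos x = 0. *)
have [rho rho0 cos_small] : exists2 rho : R, 0 < rho <= pi / 2 &
    forall x, pi / 2 <= x <= pi / 2 + rho -> `|2 * s * cos x| <= r.
  have : continuous (fun x : R => 2 * s * cos x).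
    by move=> x; apply: cvgM; [exact: cvg_cst | exact: continuous_cos].
  move=> /(_ (pi / 2)) /cvgrPdist_le /(_ _ r0).
  rewrite cos_pihalf mulr0 => -[/= d d0 hd].
  exists (Num.min (d / 2) (pi / 2)).
    by rewrite lt_min !divr_gt0//= ge_min lexx orbT.
  move=> x /andP[x1 x2]; have := hd x; rewrite sub0r normrN; apply.
  rewrite /= distrC ger0_norm ?subr_ge0//.
  have : Num.min (d / 2) (pi / 2) <= d / 2 by rewrite ge_min lexx.
  lra.
case/andP: rho0 => rho0 rho_pi.
pose I : set R := `[pi / 2, pi / 2 + rho]%classic.
pose bump (x : R) : \bar R := (e * \1_I x)%:E.
have mbump : measurable_fun setT bump.
  apply/measurable_EFinP; apply: measurable_funM => //.
  by apply: measurable_indic; exact: measurable_itv.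
have bump0 x : (0 <= bump x)%E by rewrite lee_fin mulr_ge0// ltW.
have int_bump : (\int[mu]_(x in `[0%R, (2 * pi)%R]) bump x = (e * rho)%:E)%E.
  rewrite /bump; under eq_integral do rewrite EFinM.
  rewrite ge0_integralZl//; last 2 first.
  - by apply/measurable_EFinP; apply: measurable_funTS; apply: measurable_indic;
      exact: measurable_itv.
  - by rewrite lee_fin ltW.
  rewrite integral_indic//; last exact: measurable_itv.
  rewrite setIidl; last first.
    move=> x; rewrite /I /= !in_itv /= => /andP[x1 x2]; apply/andP; split; lra.
  rewrite /I /= lebesgue_measure_itv /= lte_fin ltrDl rho0 -EFinB addrAC subrr add0r.
  by rewrite EFinM.
have above : (\int[mu]_(x in `[0%R, (2 * pi)%R])
      (\int[nu]_y capped (2 * s * cos x) y + bump x) <=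
    \int[mu]_(x in `[0%R, (2 * pi)%R]) (c - phi (2 * s * cos x))%:E)%E.
  apply: ge0_le_integral => //.
  - move=> x _; apply: adde_ge0 => //.
    by apply: integral_ge0 => y _; exact: capped_log_ge0.
  - apply: emeasurable_funD; apply: measurable_funTS => //.
  - apply/measurable_EFinP; apply: measurable_funTS.
    exact: continuous_measurable_fun continuous_phi_cos.
  move=> x _; rewrite capped_potential; last first.
    have := cos_bound x; have := ck; move: s0; lra.
  have u2 := cos_bound x; rewrite /bump indicE.
  have := pot _ u2; have := pot_r _ u2.
  have : x \in I -> `|2 * s * cos x| <= r.
    by rewrite inE /I /= in_itv /=; exact: cos_small.
  case: (x \in I) => [/(_ isT) ur /(_ ur)|_ _].
    rewrite mulr1; case: (\int[nu]_y _)%E => [v| |]//.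
      by rewrite -!EFinD !lee_fin; lra.
    by move=> _ _; exact: leNye.
  rewrite mulr0; case: (\int[nu]_y _)%E => [v| |]//.
    by rewrite -!EFinD !lee_fin; lra.
  by move=> _; exact: leNye.
move: energy; rewrite integral_arcsine_capped.
move: above; rewrite ge0_integralD//; last 3 first.
- by move=> x _; apply: integral_ge0 => y _; exact: capped_log_ge0.
- exact: measurable_funTS.
- exact: measurable_funTS.
rewrite int_bump integral_phi_cos.
have : (0 <= \int[mu]_(x in `[0%R, (2 * pi)%R])
    \int[nu]_y capped (2 * s * cos x) y)%E.
  by apply: integral_ge0 => x _; apply: integral_ge0 => y _; exact: capped_log_ge0.
case: (\int[mu]_(x in _) _)%E => [v| |]// _.
  rewrite -EFinD -EFinM !lee_fin => v1.
  rewrite ler_pdivlMl ?pi2_gt0// => v2.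
  have : 0 < e * rho by rewrite mulr_gt0.
  lra.
Qed.

End arcsine_averaging.

(** * Chebyshev polynomials and the expansion of the logarithm *)

Section chebyshev.
Context {R : realType}.
Implicit Types (x r B : R) (n k : nat).

(** The Chebyshev polynomials of the first kind, normalised on [-2, 2]: they map
    2 cos x to 2 cos (n x), and w + 1/w to w^n + 1/w^n. *)
Fixpoint cheb n : {poly R} :=
  match n with
  | 0 => 2%:P
  | 1 => 'X
  | (n'.+1 as n1).+1 => 'X * cheb n1 - cheb n'
  end.

Arguments cheb : simpl never.

Lemma chebSS n : cheb n.+2 = 'X * cheb n.+1 - cheb n.
Proof. by []. Qed.

Lemma horner_chebSS n x :
  (cheb n.+2).[x] = x * (cheb n.+1).[x] - (cheb n).[x].
Proof. by rewrite chebSS !hornerE. Qed.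

Lemma nat_ind2 (P : nat -> Prop) :
  P 0%N -> P 1%N -> (forall n, P n -> P n.+1 -> P n.+2) -> forall n, P n.
Proof.
move=> P0 P1 PS n; suff [] : P n /\ P n.+1 by [].
by elim: n => [|n [? ?]]; split=> //; exact: PS.
Qed.

Lemma cheb_cos n x : (cheb n).[2 * cos x] = 2 * cos (x *+ n).
Proof.
elim/nat_ind2: n => [||n ih1 ih2]; first by rewrite hornerC mulr0n cos0 mulr1.
  by rewrite hornerX mulr1n.
rewrite horner_chebSS ih1 ih2.
have -> : x *+ n.+2 = x *+ n.+1 + x by rewrite mulrSr.
have -> : x *+ n = x *+ n.+1 - x by rewrite mulrSr addrK.
rewrite cosB cosD; ring.
Qed.

(** Having all degrees, these polynomials span {poly R}. *)
Lemma cheb_monic_size n : (cheb n.+1 \is monic) /\ size (cheb n.+1) = n.+2.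
Proof.
have key (p q : {poly R}) m : p \is monic -> size p = m.+2 ->
    (size q <= m.+2)%N -> ('X * p - q \is monic) /\ size ('X * p - q)%R = m.+3.
  move=> pm sp sq; have pn0 : p != 0 by rewrite monic_neq0.
  have sXp : size ('X * p)%R = m.+3 by rewrite mulrC size_mulX// sp.
  have sN : (size (- q)%R < size ('X * p)%R)%N by rewrite size_polyN sXp ltnS.
  split; last by rewrite size_polyDl.
  by rewrite monicE lead_coefDl// mulrC lead_coefMX -monicE.
suff [//] : (cheb n.+1 \is monic /\ size (cheb n.+1) = n.+2) /\
  (cheb n.+2 \is monic /\ size (cheb n.+2) = n.+3).
elim: n => [|n [[m1 s1] [m2 s2]]]; split.
- by rewrite /= monicX size_polyX.
- by rewrite chebSS; apply: key; rewrite ?monicX ?size_polyX ?size_polyC//=;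
    case: (_ != 0).
- by split.
- by rewrite chebSS; apply: key => //; rewrite s1.
Qed.

Lemma cheb_bound n x B : `|x| <= B -> `|(cheb n).[x]| <= 2 * (B + 1) ^+ n.
Proof.
move=> xB; have B0 : 0 <= B by apply: le_trans xB.
elim/nat_ind2: n => [||n ih1 ih2].
- by rewrite hornerC expr0 mulr1 ger0_norm.
- rewrite hornerX expr1; lra.
rewrite horner_chebSS; apply: le_trans (ler_normB _ _) _; rewrite normrM.
have h : `|x| * `|(cheb n.+1).[x]| <= B * (2 * (B + 1) ^+ n.+1).
  by apply: ler_pM.
have := exprn_ge0 n (_ : 0 <= B + 1).
move=> /(_ (addr_ge0 B0 ler01)) p0.
move: h ih1; rewrite !exprS; move: p0; move: ((B + 1) ^+ n) => p p0 h ih1.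
nra.
Qed.

(** The partial sums of the generating function of these polynomials, which is
    minus the logarithmic derivative in r of 1 - x r + r^2. *)
Lemma cheb_geom n x r : (1 - x * r + r ^+ 2) *
    (\sum_(k < n) (cheb k.+1).[x] * r ^+ k) =
  x - 2 * r - (cheb n.+1).[x] * r ^+ n + (cheb n).[x] * r ^+ n.+1.
Proof.
elim: n => [|n ih].
  by rewrite big_ord0 mulr0 expr0 expr1 hornerX hornerC; ring.
rewrite big_ord_recr mulrDr ih horner_chebSS !exprS /=; ring.
Qed.

(** The remainder in ln (1 - x r + r^2) = - sum_(k >= 1) cheb_k(x) r^k / k. *)
Definition log_tail n x r : R :=
  ln (1 - x * r + r ^+ 2) + \sum_(k < n) (cheb k.+1).[x] * r ^+ k.+1 / k.+1%:R.

Lemma is_derive_log_tail n x r : 0 < 1 - x * r + r ^+ 2 ->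
  is_derive r 1 (log_tail n x)
    (((cheb n).[x] * r ^+ n.+1 - (cheb n.+1).[x] * r ^+ n) /
     (1 - x * r + r ^+ 2)).
Proof.
move=> d0.
have dq : is_derive r 1 (fun r : R => 1 - x * r + r ^+ 2) (2 * r - x).
  by apply: is_derive_eq; rewrite /GRing.scale /=; ring.
have dln : is_derive (1 - x * r + r ^+ 2) 1 (@ln R) (1 - x * r + r ^+ 2)^-1.
  exact: is_derive1_ln.
have d1 := @is_derive1_comp R (@ln R) (fun r : R => 1 - x * r + r ^+ 2) r _ _ dln dq.
have d2 : is_derive r 1
    (\sum_(k < n) (fun r : R => (cheb k.+1).[x] * r ^+ k.+1 / k.+1%:R))
    (\sum_(k < n) (cheb k.+1).[x] * r ^+ k).
  apply: is_derive_sum => k.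
  rewrite (_ : (fun _ => _) = ((cheb k.+1).[x] / k.+1%:R) *: (@id R ^+ k.+1)).
    by apply: is_derive_eq; rewrite /GRing.scale /= mulr1 mulrA divfK//.
  by apply/funext => u; rewrite !fctE /GRing.scale /= mulrAC.
have := is_deriveD d1 d2.
have -> : (@ln R \o (fun r : R => 1 - x * r + r ^+ 2)) +
   \sum_(k < n) (fun r : R => (cheb k.+1).[x] * r ^+ k.+1 / k.+1%:R) =
   log_tail n x.
  by apply/funext => u; rewrite /log_tail /= fctE fct_sumE.
move=> /is_derive_eq; apply.
apply: (mulfI (lt0r_neq0 d0)).
rewrite mulrDr cheb_geom mulrA divff ?gt_eqF// mul1r mulrCA divff ?gt_eqF//; ring.
Qed.


(** The derivative of the remainder has a factor r^n by [cheb_geom], and the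
    condition on r keeps its denominator at least 1/2. *)
Lemma log_tail_bound n x r B : `|x| <= B -> 0 <= r -> r * (2 * (B + 1)) <= 1 ->
  `|log_tail n x r| <= 8 * (B + 1) ^+ n.+1 * r ^+ n.+1.
Proof.
move=> xB r0 rB; have B0 : 0 <= B by apply: le_trans xB.
have denom u : 0 <= u -> u <= r -> 2^-1 <= 1 - x * u + u ^+ 2.
  move=> u0 ur; move: xB; rewrite ler_norml => /andP[x1 x2].
  have : x * u <= B * u by apply: ler_wpM2r.
  have : u * (2 * (B + 1)) <= r * (2 * (B + 1)) by apply: ler_wpM2r => //; lra.
  have := sqr_ge0 u; nra.
have denom_gt0 u : 0 <= u -> u <= r -> 0 < 1 - x * u + u ^+ 2.
  by move=> u0 ur; apply: lt_le_trans (denom u u0 ur).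
have tail0 : log_tail n x 0 = 0.
  rewrite /log_tail mulr0 expr0n subr0 addr0 ln1 add0r big1// => k _.
  by rewrite expr0n mulr0 mul0r.
have [->|r_neq0] := eqVneq r 0.
  by rewrite tail0 normr0 expr0n mulr0.
have r_gt0 : 0 < r by rewrite lt_def r_neq0.
have deriv u : u \in `]0, r[ -> is_derive u 1 (log_tail n x)
    (((cheb n).[x] * u ^+ n.+1 - (cheb n.+1).[x] * u ^+ n) / (1 - x * u + u ^+ 2)).
  rewrite in_itv /= => /andP[u0 ur]; apply: is_derive_log_tail.
  by apply: denom_gt0; exact: ltW.
have cont : {within `[0, r], continuous (log_tail n x)}.
  apply: derivable_within_continuous => u; rewrite in_itv /= => /andP[u0 ur].
  have := is_derive_log_tail n x u (denom_gt0 u u0 ur).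
  by move=> h; exact: ex_derive.
have [u] := MVT r_gt0 deriv cont.
rewrite in_itv /= => /andP[u0 ur]; rewrite tail0 subr0 subr0 => ->.
rewrite normrM [`|r|]ger0_norm// [r ^+ n.+1]exprSr mulrA ler_wpM2r//.
rewrite normrM normfV [X in _ / X]gtr0_norm ?denom_gt0 ?(ltW u0) ?(ltW ur)//.
rewrite ler_pdivrMr ?denom_gt0 ?(ltW u0) ?(ltW ur)//.
apply: (@le_trans _ _ (8 * (B + 1) ^+ n.+1 * r ^+ n * 2^-1)); last first.
  apply: ler_wpM2l; last by apply: denom; exact: ltW.
  by rewrite !mulr_ge0// exprn_ge0//; lra.
have un : u ^+ n <= r ^+ n by apply: lerXn2r; rewrite ?nnegrE ?ltW.
have un0 : 0 <= u ^+ n by rewrite exprn_ge0// ltW.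
apply: le_trans (ler_normB _ _) _; rewrite !normrM.
have b1 := cheb_bound n x B xB; have b2 := cheb_bound n.+1 x B xB.
rewrite [`|u ^+ n.+1|]ger0_norm ?exprn_ge0 ?(ltW u0)//.
rewrite [`|u ^+ n|]ger0_norm//.
have p0 : 0 <= (B + 1) ^+ n by rewrite exprn_ge0; lra.
have i1 : `|(cheb n).[x]| * u ^+ n.+1 <= 2 * (B + 1) ^+ n.+1 * r ^+ n.
  rewrite !exprS; apply: (@le_trans _ _ (2 * (B + 1) ^+ n * (1 * u ^+ n))).
    apply: ler_pM => //; first by rewrite mulr_ge0// ltW.
    apply: ler_wpM2r => //; nra.
  rewrite mul1r; apply: ler_pM => //; first by rewrite mulr_ge0.
  nra.
have i2 : `|(cheb n.+1).[x]| * u ^+ n <= 2 * (B + 1) ^+ n.+1 * r ^+ n.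
  by apply: ler_pM.
lra.
Qed.

Lemma coef_eq0_of_small (a : nat -> R) :
  (forall n, exists M r1, 0 < r1 /\ forall r, 0 < r -> r <= r1 ->
     `|\sum_(k < n) a k.+1 * r ^+ k.+1| <= M * r ^+ n.+1) ->
  forall n, a n.+1 = 0.
Proof.
move=> small n; elim/ltn_ind: n => n ih.
have [M [r1 [r1_gt0 hM]]] := small n.+1.
have bound r : 0 < r -> r <= r1 -> `|a n.+1| <= M * r.
  move=> r0 rr; have := hM r r0 rr.
  rewrite big_ord_recr big1 /= => [|k _]; last by rewrite ih ?mul0r// ltn_ord.
  rewrite add0r normrM [`|r ^+ _|]gtr0_norm ?exprn_gt0//.
  by rewrite [r ^+ n.+2]exprS mulrA ler_pM2r ?exprn_gt0.
apply/eqP; rewrite -normr_le0; apply/ler_addgt0Pl => e e0; rewrite addr0.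
have M0 : 0 <= M.
  have := bound r1 r1_gt0 (lexx _) => h.
  by rewrite -(pmulr_lge0 _ r1_gt0) (le_trans _ h).
pose r := Num.min r1 (e / (M + 1)).
have r0 : 0 < r by rewrite lt_min r1_gt0 divr_gt0//; lra.
have rr1 : r <= r1 by rewrite ge_min lexx.
have re : r <= e / (M + 1) by rewrite ge_min lexx orbT.
apply: le_trans (bound r r0 rr1) _.
move: re; rewrite ler_pdivlMr; last by lra.
nra.
Qed.

End chebyshev.

Lemma continuous_horner_div (R : realType) (p : {poly R}) (s : R) :
  continuous (fun x : R => p.[x / s]).
Proof.
have -> : (fun x => p.[x / s]) = horner (p \Po (s^-1 *: 'X)).
  by apply/funext => x; rewrite horner_comp hornerZ hornerX mulrC.
exact: continuous_horner.
Qed.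

(** * Chebyshev moments read off from a potential *)

Section chebyshev_moments.
Context {R : realType}.
Notation mu := (@lebesgue_measure R).
Variables (m : probability R R) (s K : R).
Hypotheses (s0 : 0 < s).
Let D : set R := `[- K, K]%classic.

Let mD : measurable D. Proof. exact: measurable_itv. Qed.

Let mD_lty : (m D < +oo)%E.
Proof. by rewrite (le_lt_trans (probability_le1 m mD)) ?ltry. Qed.

Let DK x : D x -> `|x / s| <= K / s.
Proof.
rewrite /D /= in_itv /= => /andP[x1 x2]; rewrite normrM normfV [`|s|]gtr0_norm//.
by rewrite ler_pM2r ?invr_gt0// ler_norml x1.
Qed.

Lemma bounded_integrable (f : R -> R) (M : R) : measurable_fun D f ->
  (forall x, D x -> `|f x| <= M) -> m.-integrable D (EFin \o f).
Proof.
move=> mf fM; apply: measurable_bounded_integrable => //.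
exists M; split => [|B MB x Dx]; first exact: num_real.
exact: le_trans (fM x Dx) (ltW MB).
Qed.

Lemma measurable_horner (p : {poly R}) : measurable_fun D (fun x => p.[x / s]).
Proof.
apply: measurable_funTS; apply: continuous_measurable_fun.
exact: continuous_horner_div.
Qed.

Lemma cheb_integrable n :
  m.-integrable D (EFin \o (fun x => (cheb n).[x / s])).
Proof.
apply: (bounded_integrable _ (2 * (K / s + 1) ^+ n)); first exact: measurable_horner.
by move=> x /DK; exact: cheb_bound.
Qed.

Lemma log_tail_integrable j r : 0 <= r -> r * (2 * (K / s + 1)) <= 1 ->
  m.-integrable D (EFin \o (fun x => log_tail j (x / s) r)).
Proof.
move=> r0 rK.
apply: (bounded_integrable _ (8 * (K / s + 1) ^+ j.+1 * r ^+ j.+1)).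
  rewrite /log_tail; apply: measurable_funD.
    apply: measurable_funTS; apply: (measurableT_comp (@measurable_ln R)).
    apply: continuous_measurable_fun => x; apply: cvgD; last exact: cvg_cst.
    apply: cvgB; first exact: cvg_cst.
    by do 2! (apply: cvgM; last exact: cvg_cst); exact: cvg_id.
  apply: measurable_sum => k; apply: measurable_funM => //.
  by apply: measurable_funM => //; exact: measurable_horner.
by move=> x /DK xK; exact: log_tail_bound.
Qed.

Lemma Rintegral_log_tail n r : 0 <= r -> r * (2 * (K / s + 1)) <= 1 ->
  \int[m]_(x in D) log_tail n (x / s) r =
  \int[m]_(x in D) ln (1 - x / s * r + r ^+ 2) +
  \sum_(k < n) (\int[m]_(x in D) (cheb k.+1).[x / s]) * r ^+ k.+1 / k.+1%:R.
Proof.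
move=> r0 rK.
have tail_int j := log_tail_integrable j r r0 rK.
elim: n => [|n ih].
  rewrite big_ord0 addr0; apply: eq_Rintegral => x _.
  by rewrite /log_tail big_ord0 addr0.
rewrite big_ord_recr addrA -ih /=.
have -> : \int[m]_(x in D) log_tail n.+1 (x / s) r =
  \int[m]_(x in D) (log_tail n (x / s) r + (cheb n.+1).[x / s] * (r ^+ n.+1 / n.+1%:R)).
  by apply: eq_Rintegral => x _; rewrite /log_tail big_ord_recr /= addrA mulrA.
rewrite RintegralD//; last first.
  apply: (bounded_integrable _ (2 * (K / s + 1) ^+ n.+1 * `|r ^+ n.+1 / n.+1%:R|)).
    by apply: measurable_funM => //; exact: measurable_horner.
  move=> x /DK xK; rewrite normrM ler_wpM2r//; exact: cheb_bound.
by rewrite RintegralZr//; [rewrite mulrA | exact: cheb_integrable].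
Qed.

(** Integrating the expansion of ln (1 - Y r + r^2) in powers of r and comparing
    with r^2 / 2 identifies the Chebyshev moments one after the other. *)
Lemma cheb_moments (r0 : R) : 0 < r0 -> 0 <= K ->
  (forall r, 0 < r -> r <= r0 ->
     \int[m]_(x in D) ln (1 - x / s * r + r ^+ 2) = r ^+ 2 / 2) ->
  forall n, \int[m]_(x in D) (cheb n.+1).[x / s] = - (n == 1%N)%:R.
Proof.
move=> r0_gt0 K0 hlog n.
pose c k := \int[m]_(x in D) (cheb k).[x / s].
pose a k := (c k + (k == 2)%:R) / k%:R.
(* The quadratic term r^2 / 2 is absorbed in the coefficient of index 2. *)
suff : a n.+1 = 0.
  rewrite /a => /eqP; rewrite mulf_eq0 invr_eq0 pnatr_eq0 orbF addr_eq0 => /eqP.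
  by rewrite /c eqSS.
have B0 : 0 <= K / s by rewrite divr_ge0// ltW.
pose r1 := Num.min r0 (2 * (K / s + 1))^-1.
have r1_gt0 : 0 < r1 by rewrite lt_min r0_gt0 invr_gt0//; lra.
have tail_bound j r : 0 < r -> r <= r1 ->
    `|\sum_(k < j) c k.+1 * r ^+ k.+1 / k.+1%:R + r ^+ 2 / 2| <=
    8 * (K / s + 1) ^+ j.+1 * r ^+ j.+1.
  move=> r_gt0; rewrite le_min => /andP[rr0].
  rewrite -[X in r <= X]mul1r ler_pdivlMr => [rK|]; last by lra.
  rewrite addrC -(hlog r r_gt0 rr0) -(Rintegral_log_tail _ _ (ltW r_gt0) rK).
  have tail_int := log_tail_integrable j r (ltW r_gt0) rK.
  apply: le_trans (le_normr_Rintegral mD tail_int) _.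
  set M := 8 * _ * _; have M0 : 0 <= M.
    by rewrite !mulr_ge0// exprn_ge0 ?addr_ge0// ltW.
  apply: (@le_trans _ _ (\int[m]_(x in D) M)); last first.
    rewrite Rintegral_cst// ler_piMr// -lee_fin fineK ?probability_le1//.
    by rewrite ge0_fin_numE.
  apply: le_Rintegral => //.
  - exact: integrable_norm.
  - by apply: (bounded_integrable _ M) => // x _; rewrite ger0_norm.
  by move=> x /DK xK; apply: log_tail_bound => //; exact: ltW.
apply: (coef_eq0_of_small a) => j.
case: j => [|[|j]].
- by exists 0, 1; split => // r _ _; rewrite big_ord0 normr0 mul0r.
- exists (8 * (K / s + 1) ^+ 2 + 2^-1), r1; split => // r r_gt0 rr1.
  have := tail_bound 1%N r r_gt0 rr1.
  rewrite !big_ord1 /a /= addr0 divr1 !divr1.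
  have := sqr_ge0 r.
  rewrite mulrDl !ler_norml => ? /andP[? ?]; apply/andP; split; lra.
- exists (8 * (K / s + 1) ^+ j.+3), r1; split => // r r_gt0 rr1.
  rewrite (_ : \sum_(k < j.+2) _ =
    \sum_(k < j.+2) c k.+1 * r ^+ k.+1 / k.+1%:R + r ^+ 2 / 2).
    exact: tail_bound.
  rewrite [LHS](eq_bigr (fun k : 'I_j.+2 => c k.+1 * r ^+ k.+1 / k.+1%:R +
    (k == 1%N :> nat)%:R * r ^+ 2 / 2)).
    rewrite big_split /=; congr (_ + _).
    rewrite !big_ord_recl big1 /=; last by move=> k _; rewrite !mul0r.
    by rewrite !mul0r add0r mul1r addr0.
  move=> k _; rewrite /a eqSS; case: eqP => [->|_] /=.
    by rewrite mul1r; field.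
  by rewrite addr0 !mul0r addr0 mulrAC.
Qed.

End chebyshev_moments.

(** * Chebyshev moments of the semicircle law *)

Section semicircle_moments.
Context {R : realType}.
Notation mu := (@lebesgue_measure R).
Implicit Types (x : R) (n k : nat).

Lemma sin_natpi k : sin (pi *+ k) = 0 :> R.
Proof.
elim: k => [|k ih]; first by rewrite mulr0n sin0.
by rewrite mulrSr sinD ih sinpi mul0r mulr0 addr0.
Qed.

Lemma Rintegral_cos_nat k :
  \int[mu]_(x in `[0%R, pi]) cos (x *+ k) = if k == 0%N then pi else 0.
Proof.
case: k => [|k] /=.
  under eq_Rintegral do rewrite mulr0n cos0.
  by rewrite Rintegral_cst//= lebesgue_measure_itv /= lte_fin pi_gt0 -EFinB /=
    subr0 mul1r.
pose F x : R := k.+1%:R^-1 * sin (k.+1%:R * x).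
have dF x : is_derive x (1 : R) F (cos (x *+ k.+1)).
  rewrite /F; have dk : is_derive x (1 : R) (fun x : R => k.+1%:R * x) k.+1%:R.
    by apply: is_derive_eq; rewrite /GRing.scale /= mulr1.
  have ds := @is_derive1_comp R (@sin R) (fun x : R => k.+1%:R * x) x _ _
    (is_derive_sin _) dk.
  have := is_deriveZ k.+1%:R^-1 ds => /is_derive_eq; apply.
  by rewrite /GRing.scale /= mulrCA mulVf ?pnatr_eq0// mulr1 mulr_natl.
have cc : continuous (fun x : R => cos (x *+ k.+1)).
  move=> x; apply: (@continuous_comp _ _ _ (fun x => x *+ k.+1) cos).
    exact: (@natmul_continuous _ R k.+1).
  exact: continuous_cos.
rewrite /Rintegral (@continuous_FTC2 R _ F 0 pi (pi_gt0 R)).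
- by rewrite /F mulr0 sin0 mulr0 mulr_natl sin_natpi mulr0 -EFinB subrr.
- exact: continuous_subspaceT cc.
- split => [x _||]; first by apply: ex_derive.
  + apply: cvg_at_right_filter; apply: differentiable_continuous.
    by apply/derivable1_diffP; apply: ex_derive.
  + apply: cvg_at_left_filter; apply: differentiable_continuous.
    by apply/derivable1_diffP; apply: ex_derive.
- by move=> x _; rewrite derive1E; apply: derive_val.
Qed.

Variables (s : R).
Hypothesis s0 : 0 < s.

Definition sc_density (t x : R) : R := Num.sqrt (4 * t - x ^+ 2) / (2 * pi * t).

Let seg : set R := `[- (2 * s), 2 * s]%classic.

Lemma continuous_sc_density t : continuous (sc_density t).
Proof.
move=> x; apply: cvgM; last exact: cvg_cst.
apply: (@continuous_comp _ _ _ (fun x => 4 * t - x ^+ 2) Num.sqrt).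
  by apply: cvgB; [exact: cvg_cst | exact: exprn_continuous].
exact: sqrt_continuous.
Qed.

Lemma sc_density_cos x : 0 <= sin x ->
  sc_density (s ^+ 2) (2 * s * cos x) * (2 * s * sin x) = 2 / pi * sin x ^+ 2.
Proof.
move=> sx; rewrite /sc_density.
have -> : 4 * s ^+ 2 - (2 * s * cos x) ^+ 2 = (2 * s * sin x) ^+ 2.
  rewrite [RHS]exprMn sin2cos2; ring.
rewrite sqrtr_sqr ger0_norm ?mulr_ge0// ?ltW//.
have := lt0r_neq0 (pi_gt0 R); have := lt0r_neq0 s0.
move: (pi : R) => p s_neq0 p0; field.
by rewrite p0.
Qed.

(** The substitution 2 s cos x turns the semicircle law into the measure of
    density (2 / pi) sin^2 x on [0, pi]. *)
Lemma Rintegral_sc_cos (f : R -> R) : continuous f ->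
  \int[mu]_(x in seg) (f x * sc_density (s ^+ 2) x) =
  2 / pi * \int[mu]_(x in `[0%R, pi]) (f (2 * s * cos x) * sin x ^+ 2).
Proof.
move=> cf; pose F x := 2 * s * cos x.
have cF : continuous F.
  by move=> x; apply: cvgM; [exact: cvg_cst | exact: continuous_cos].
have dF x : is_derive x (1 : R) F (- (2 * s * sin x)).
  by rewrite /F; apply: is_derive_eq; rewrite /GRing.scale /= mulrN.
have F' : F^`()%classic = fun x => - (2 * s * sin x).
  by apply/funext => x; rewrite derive1E; apply: derive_val.
have cF' : continuous (F^`()%classic).
  rewrite F' => x; apply: cvgN; apply: cvgM; [exact: cvg_cst|].
  exact: continuous_sin.
have segE : seg = `[F pi, F 0]%classic.
  by rewrite /F cospi cos0 mulr1 mulrN1.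
rewrite segE [LHS]/Rintegral (@integration_by_substitution_decreasing R F _ 0 pi).
- rewrite -RintegralZl//; last first.
    apply: continuous_itv_integrable => x; apply: cvgM.
      apply: (@continuous_comp _ _ _ F f); [exact: cF | exact: cf].
    apply: (@continuous_comp _ _ _ sin (fun y => y ^+ 2)).
      exact: continuous_sin.
    exact: exprn_continuous.
  congr fine; apply: eq_integral => x /set_mem; rewrite /= in_itv /= => /andP[x0 xpi].
  congr EFin; rewrite F' /= fctE opprK /F -[LHS]mulrA sc_density_cos; last first.
    by apply: sin_ge0_pi; rewrite x0.
  by rewrite mulrCA.
- exact: pi_ge0.
- by move=> x y xp yp xy; rewrite /F ltr_pM2l ?mulr_gt0// ltr_cos.
- by move=> x _; exact: cF'.
- apply/cvg_ex; exists (F^`()%classic 0).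
  by apply: cvg_at_right_filter; exact: cF'.
- apply/cvg_ex; exists (F^`()%classic pi).
  by apply: cvg_at_left_filter; exact: cF'.
- split => [x _||]; first by apply: ex_derive.
  + by apply: cvg_at_right_filter; exact: cF.
  + by apply: cvg_at_left_filter; exact: cF.
apply: continuous_subspaceT => x; apply: cvgM; first exact: cf.
exact: continuous_sc_density.
Qed.

Lemma cos_sqr_sin n x : cos (x *+ n.+2) * sin x ^+ 2 =
  2^-1 * cos (x *+ n.+2) - 4^-1 * cos (x *+ n.+4) - 4^-1 * cos (x *+ n).
Proof.
have e4 : x *+ n.+4 = x *+ n.+2 + x *+ 2 by rewrite -mulrnDr addn2.
have e0 : x *+ n = x *+ n.+2 - x *+ 2 by rewrite -addn2 mulrnDr addrK.
have key y : cos y * sin x ^+ 2 =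
    2^-1 * cos y - 4^-1 * cos (y + x *+ 2) - 4^-1 * cos (y - x *+ 2).
  by rewrite sin2cos2 cosB cosD cos_mulr2n; field.
by rewrite key -e4 -e0.
Qed.

Lemma cheb_sc_moments n :
  \int[mu]_(x in seg) ((cheb n).[x / s] * sc_density (s ^+ 2) x) =
  (if n is n'.+1 then - (n' == 1%N)%:R else 2).
Proof.
have s_neq0 := lt0r_neq0 s0.
rewrite Rintegral_sc_cos; last exact: continuous_horner_div.
have cc k : continuous (fun x : R => cos (x *+ k)).
  move=> x; apply: (@continuous_comp _ _ _ (fun x => x *+ k) cos).
    exact: (@natmul_continuous _ R k).
  exact: continuous_cos.
have ccc (c : R) k : continuous (fun x : R => c * cos (x *+ k)).
  by move=> x; apply: cvgM; [exact: cvg_cst | exact: cc].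
have icc (c : R) k :
    mu.-integrable `[0%R, pi] (EFin \o (fun x : R => c * cos (x *+ k))).
  exact: continuous_itv_integrable.
have int_c (c : R) k : \int[mu]_(x in `[0%R, pi]) (c * cos (x *+ k)) =
    c * if k == 0%N then pi else 0.
  by rewrite RintegralZl ?Rintegral_cos_nat//; exact: continuous_itv_integrable.
have lin (c1 c2 c3 : R) k1 k2 k3 :
    \int[mu]_(x in `[0%R, pi]) (c1 * cos (x *+ k1) - c2 * cos (x *+ k2)
      - c3 * cos (x *+ k3)) =
    c1 * (if k1 == 0%N then pi else 0) - c2 * (if k2 == 0%N then pi else 0)
      - c3 * (if k3 == 0%N then pi else 0).
  rewrite RintegralB// ?RintegralB ?int_c//.
  apply: continuous_itv_integrable => x.
  by apply: cvgB; exact: ccc.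
have pi_neq0 := lt0r_neq0 (pi_gt0 R).
have chebE x : (cheb n).[2 * s * cos x / s] = 2 * cos (x *+ n).
  by rewrite -cheb_cos; congr horner; field.
under eq_Rintegral do rewrite chebE.
case: n chebE => [|[|n]] _.
- under eq_Rintegral => x _.
    rewrite (_ : _ * _ =
      1 * cos (x *+ 0) - 1 * cos (x *+ 2) - 0 * cos (x *+ 0)); last first.
      rewrite mulr0n cos0 cos_mulr2n sin2cos2; ring.
    over.
  by rewrite lin /= !mulr0 !subr0 mul0r subr0 mul1r divfK.
- under eq_Rintegral => x _.
    rewrite (_ : _ * _ =
      2^-1 * cos (x *+ 1) - 2^-1 * cos (x *+ 3) - 0 * cos (x *+ 0)); last first.
      have -> : x *+ 3 = x *+ 2 + x by rewrite mulrSr.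
      rewrite cosD mulr1n mul0r cos_mulr2n sin_mulr2n.
      have -> : cos x * sin x *+ 2 * sin x = 2 * cos x * sin x ^+ 2 by ring.
      rewrite sin2cos2; by field.
    over.
  by rewrite lin /= !mulr0 mul0r !subr0 mulr0 oppr0.
under eq_Rintegral => x _.
  rewrite (_ : _ * _ =
    1 * cos (x *+ n.+2) - 2^-1 * cos (x *+ n.+4) - 2^-1 * cos (x *+ n)); last first.
    rewrite -mulrA cos_sqr_sin; by field.
  over.
rewrite lin /= eqSS; move: (@pi R) pi_neq0 => p p0.
by case: (n == 0%N) => /=; field.
Qed.

End semicircle_moments.

(** * Polynomial approximation of a half-line *)

Section sharp_threshold.
Context {R : realType}.
Implicit Types (u x z : R) (n : nat).

Lemma bernoulli_ge x n : -1 <= x -> 1 + n%:R * x <= (1 + x) ^+ n.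
Proof.
move=> x1; elim: n => [|n ih]; first by rewrite mul0r addr0 expr0.
rewrite exprS; have x0 : 0 <= 1 + x by lra.
apply: (@le_trans _ _ ((1 + x) * (1 + n%:R * x))); last exact: ler_wpM2l.
rewrite -natr1; have n0 : 0 <= n%:R :> R by [].
have := sqr_ge0 x; nra.
Qed.

(** With w = sqrt z, Bernoulli's inequality bounds n w^n, and the other factor
    w^n tends to 0. *)
Lemma cvg_natM_expr z : 0 <= z -> z < 1 -> n%:R * z ^+ n @[n --> \oo] --> (0 : R).
Proof.
move=> z0 z1; pose w := Num.sqrt z.
have zE : z = w * w by rewrite -expr2 sqr_sqrtr.
have w0 : 0 <= w by exact: sqrtr_ge0.
have w1 : w < 1 by rewrite ltNge; apply/negP => w1; nra.
have lim : (1 - w)^-1 * w ^+ n @[n --> \oo] --> (0 : R).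
  by rewrite -(mulr0 (1 - w)^-1); apply: cvgMr; apply: cvg_expr; rewrite ger0_norm.
have lim0 : (fun _ : nat => 0 : R) @ \oo --> (0 : R) by exact: cvg_cst.
apply: (squeeze_cvgr _ lim0 lim); apply: nearW => n; apply/andP; split.
  by rewrite mulr_ge0// exprn_ge0.
have wn0 : 0 <= w ^+ n by rewrite exprn_ge0.
rewrite zE exprMn mulrA; apply: ler_wpM2r => //.
rewrite -[leRHS]mul1r ler_pdivlMr ?subr_gt0//.
have h : n%:R * (1 - w) * w ^+ n <= 1.
  have [w_eq0|w_neq0] := eqVneq w 0.
    rewrite w_eq0 expr0n subr0 mulr1; case: n {wn0} => [|n]; first by rewrite mul0r.
    by rewrite /= mulr0.
  have w_gt0 : 0 < w by rewrite lt_def w_neq0.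
  have := bernoulli_ge (w^-1 - 1) n.
  have wV : 1 <= w^-1 by rewrite invf_ge1// ltW.
  have -> : 1 + (w^-1 - 1) = w^-1 by ring.
  rewrite exprVn => /(_ ltac:(lra)) => b.
  rewrite -ler_pdivlMr ?exprn_gt0// mul1r; apply: le_trans b.
  have : n%:R * (1 - w) <= n%:R * (w^-1 - 1).
    apply: ler_wpM2l => //.
    have : w * w^-1 = 1 by rewrite mulfV.
    nra.
  lra.
by rewrite mulrAC.
Qed.

Lemma expr_onem_le x n : 0 <= x -> x <= 1 -> (1 - x) ^+ n <= (1 + n%:R * x)^-1.
Proof.
move=> x0 x1; have h : 0 < 1 + n%:R * x by rewrite ltr_pwDl// mulr_ge0.
rewrite -[leRHS]mul1r ler_pdivlMr//.
apply: (@le_trans _ _ ((1 - x) ^+ n * (1 + x) ^+ n)).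
  by apply: ler_wpM2l; [rewrite exprn_ge0; lra | apply: bernoulli_ge; lra].
rewrite -exprMn; apply: exprn_ile1; nra.
Qed.

(** With N = n 2^n, the quantity N u^n tends to 0 for u < 1/2 and to infinity for
    u >= 1/2, including at u = 1/2 thanks to the factor n; Bernoulli's inequality
    transfers this to (1 - u^n)^N. *)
Lemma cvg_sharp_threshold u : 0 <= u -> u <= 1 ->
  (((1 - u ^+ n) ^+ (n * 2 ^ n)%N)%R @[n --> \oo]) --> ((u < 2^-1)%R%:R : R).
Proof.
move=> u0 u1.
have un0 n : 0 <= u ^+ n by rewrite exprn_ge0.
have un1 n : u ^+ n <= 1 by rewrite exprn_ile1.
have [u2|u2] := ltP u 2^-1.
  have lim : 1 - n%:R * (2 * u) ^+ n @[n --> \oo] --> (1 - 0 : R).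
    apply: cvgB; first exact: cvg_cst.
    by apply: cvg_natM_expr; lra.
  rewrite subr0 in lim.
  have lim1 : (fun _ : nat => 1 : R) @ \oo --> (1 : R) by exact: cvg_cst.
  apply: (squeeze_cvgr _ lim lim1); apply: nearW => n; apply/andP; split.
    have := bernoulli_ge (- u ^+ n) (n * 2 ^ n).
    rewrite lerN2 => /(_ (un1 n)); apply: le_trans.
    by rewrite exprMn natrM natrX mulrN mulrA.
  by apply: exprn_ile1; have := un0 n; have := un1 n; lra.
have lim0 : (fun _ : nat => 0 : R) @ \oo --> (0 : R) by exact: cvg_cst.
have lim : n.+1%:R^-1 @[n --> \oo] --> (0 : R) by exact: cvg_harmonic.
apply: (squeeze_cvgr _ lim0 lim); apply: nearW => n; apply/andP; split.
  by rewrite exprn_ge0// subr_ge0.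
apply: (@le_trans _ _ ((1 - (2^-1) ^+ n) ^+ (n * 2 ^ n)%N)).
  apply: lerXn2r; rewrite ?nnegrE ?subr_ge0//.
    by apply: exprn_ile1; lra.
  by rewrite lerD2l lerN2; apply: lerXn2r; rewrite ?nnegrE.
apply: le_trans (expr_onem_le _ _ _ _) _.
- by rewrite exprn_ge0.
- by apply: exprn_ile1; lra.
rewrite natrM natrX -mulrA -exprMn divff ?pnatr_eq0// expr1n mulr1.
by rewrite nat1r.
Qed.

End sharp_threshold.

(** * Characterisation of the semicircle law by its moments *)

Section semicircle_measure.
Context {R : realType}.
Notation mu := (@lebesgue_measure R).
Variable t : R.

Let seg : set R := `[(- (2 * Num.sqrt t))%R, (2 * Num.sqrt t)%R]%classic.
Let restricted : R -> \bar R := (fun x => (sc_density t x)%:E) \_ seg.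

Lemma semicircleE (A : set R) : semicircle t A = (\int[mu]_(x in A) restricted x)%E.
Proof. by rewrite /semicircle integral_mkcondr. Qed.

Hypothesis t0 : 0 < t.

Lemma sc_density_ge0 x : 0 <= sc_density t x.
Proof. by rewrite divr_ge0 ?sqrtr_ge0// !mulr_ge0 ?pi_ge0// ltW. Qed.

Let restricted_ge0 x : (0 <= restricted x)%E.
Proof.
by rewrite /restricted patchE; case: ifP => // _; rewrite lee_fin sc_density_ge0.
Qed.

Let measurable_restricted : measurable_fun setT restricted.
Proof.
apply/(measurable_restrictT _ (measurable_itv _)).
apply: measurable_funTS; apply/measurable_EFinP.
exact: continuous_measurable_fun (continuous_sc_density t).
Qed.

Let semicircle0 : semicircle t set0 = 0%E.
Proof. by rewrite semicircleE integral_set0. Qed.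

Let semicircle_ge0 A : (0 <= semicircle t A)%E.
Proof. by rewrite semicircleE; apply: integral_ge0 => x _. Qed.

Let semicircle_sigma_additive : semi_sigma_additive (semicircle t).
Proof.
move=> /= F mF tF mUF; rewrite semicircleE; apply: cvg_toP.
  apply: ereal_nondecreasing_is_cvgn => i j ij.
  by apply: lee_sum_nneg_natr => // k _ _; exact: semicircle_ge0.
rewrite ge0_integral_bigcup//=; last exact: measurable_funTS.
by apply: congr_lim; apply/funext => n; apply: eq_bigr => k _; rewrite semicircleE.
Qed.

(** The bundled form that uniqueness theorems for measures expect. *)
Definition semicircle_measure : {measure set R -> \bar R} :=
  HB.pack (semicircle t : set R -> \bar R)
    (isMeasure.Build _ _ _ (semicircle t : set R -> \bar R)
    semicircle0 semicircle_ge0 semicircle_sigma_additive).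

End semicircle_measure.

Section semicircle_identification.
Context {R : realType}.
Notation mu := (@lebesgue_measure R).
Variables (m : probability R R) (s : R).
Hypothesis (s0 : 0 < s).

Let seg : set R := `[- (2 * s), 2 * s]%classic.

Section fixed_interval.
Variable K : R.
Let D : set R := `[- K, K]%classic.
Hypotheses (mD1 : m D = 1%E)
  (moments : forall n, \int[m]_(x in D) (cheb n.+1).[x / s] = - (n == 1%N)%:R).

Let mD : measurable D. Proof. exact: measurable_itv. Qed.

Let horner_sc_integrable (p : {poly R}) :
  mu.-integrable seg (EFin \o (fun x => p.[x / s] * sc_density (s ^+ 2) x)).
Proof.
apply: continuous_itv_integrable => x; apply: cvgM.
  exact: continuous_horner_div.
exact: continuous_sc_density.
Qed.

Let horner_integrable (p : {poly R}) :
  m.-integrable D (EFin \o (fun x => p.[x / s])).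
Proof.
have : compact [set p.[x / s] | x in D].
  apply: continuous_compact; last exact: segment_compact.
  by apply: continuous_subspaceT; exact: continuous_horner_div.
move=> /compact_bounded [M [_ /(_ (M + 1))]].
rewrite ltrDl ltr01 => /(_ isT) h.
apply: (bounded_integrable m K _ (M + 1)); first exact: measurable_horner.
by move=> x Dx; apply: h; exists x.
Qed.

(** By induction on the degree, subtracting a multiple of a Chebyshev
    polynomial. *)
Lemma poly_moments (p : {poly R}) : \int[m]_(x in D) p.[x / s] =
  \int[mu]_(x in seg) (p.[x / s] * sc_density (s ^+ 2) x).
Proof.
pose L (p : {poly R}) := \int[m]_(x in D) p.[x / s] -
  \int[mu]_(x in seg) (p.[x / s] * sc_density (s ^+ 2) x).
have LD q1 q2 : L (q1 + q2) = L q1 + L q2.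
  rewrite /L; under eq_Rintegral do rewrite hornerD.
  rewrite RintegralD//.
  under [X in _ - X = _]eq_Rintegral do rewrite hornerD mulrDl.
  rewrite RintegralD//; last exact: measurable_itv.
  by rewrite opprD addrACA.
have LZ a q : L (a *: q) = a * L q.
  rewrite /L; under eq_Rintegral do rewrite hornerZ.
  rewrite RintegralZl//.
  under [X in _ - X = _]eq_Rintegral do rewrite hornerZ -mulrA.
  by rewrite RintegralZl ?mulrBr//; exact: measurable_itv.
have Lcheb n : L (cheb n) = 0.
  rewrite /L cheb_sc_moments//; case: n => [|n]; last by rewrite moments subrr.
  under eq_Rintegral do rewrite hornerC.
  rewrite Rintegral_cst// (_ : fine _ = 1) ?mulr1 ?subrr//.
  exact: (congr1 fine mD1).
suff L0 n (q : {poly R}) : (size q <= n)%N -> L q = 0.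
  by apply/eqP; rewrite -subr_eq0; apply/eqP; exact: (L0 (size p) p (leqnn _)).
elim: n q => [|n ih] q.
  rewrite leqn0 size_poly_eq0 => /eqP ->.
  by rewrite -(scale0r 0) LZ mul0r.
move=> sq.
have [sc lc] : size (@cheb R n) = n.+1 /\ lead_coef (@cheb R n) != 0.
  case: n {ih sq} => [|n].
    by rewrite size_polyC lead_coefC pnatr_eq0.
  by have [/monicP -> ->] := cheb_monic_size (R := R) n; rewrite oner_neq0.
pose a := q`_n / lead_coef (cheb n).
rewrite -(subrK (a *: cheb n) q) LD LZ Lcheb mulr0 addr0; apply: ih.
apply/leq_sizeP => j; rewrite leq_eqVlt => /predU1P[<-|nj].
  rewrite coefB coefZ /a lead_coefE sc /= divfK ?subrr//.
  by move: lc; rewrite lead_coefE sc.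
rewrite coefB coefZ !nth_default ?mulr0 ?subr0 ?sc//.
exact: leq_trans sq nj.
Qed.

Variable c : R.
Hypotheses (K0 : 0 < K) (cK : `|c| <= K) (sK : 2 * s <= K).

(** Polynomials that are bounded by 1 on [-K, K] and tend there to the indicator
    of ]-oo, c[: [level] below sends [-K, K] into [0, 1] and c to 1/2. *)
Let threshold n : {poly R} :=
  (1 - (2^-1%:P + (4 * K)^-1 *: (s *: 'X - c%:P)) ^+ n) ^+ (n * 2 ^ n).

Let level x : R := 2^-1 + (4 * K)^-1 * (x - c).

Let horner_threshold n x :
  (threshold n).[x / s] = (1 - level x ^+ n) ^+ (n * 2 ^ n).
Proof.
rewrite /threshold /level !(hornerE, horner_exp).
by rewrite /= mulrAC divff ?mul1r ?gt_eqF.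
Qed.

Let level_itv x : D x -> 0 <= level x /\ level x <= 1.
Proof.
rewrite /D /= in_itv /= => /andP[x1 x2].
move: cK; rewrite ler_norml => /andP[c1 c2].
have K4 : 0 < 4 * K by rewrite mulr_gt0.
have h1 : (4 * K)^-1 * (x - c) <= 2^-1 by rewrite ler_pdivrMl//; lra.
have h2 : - 2^-1 <= (4 * K)^-1 * (x - c) by rewrite ler_pdivlMl//; lra.
by rewrite /level; split; lra.
Qed.

Let level_lt x : (level x < 2^-1) = (x < c).
Proof.
by rewrite /level gtrDl pmulr_rlt0 ?subr_lt0// invr_gt0 mulr_gt0.
Qed.

Let threshold_cvg x : D x ->
  (threshold n).[x / s] @[n --> \oo] --> (\1_(`]-oo, c[%classic) x : R).
Proof.
move=> /level_itv [l0 l1]; under eq_fun do rewrite horner_threshold.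
have -> : \1_(`]-oo, c[%classic) x = (level x < 2^-1)%R%:R :> R.
  by rewrite level_lt indicE mem_setE in_itv.
exact: cvg_sharp_threshold.
Qed.

Let threshold_itv n x : D x -> 0 <= (threshold n).[x / s] /\ (threshold n).[x / s] <= 1.
Proof.
move=> /level_itv [l0 l1]; rewrite horner_threshold.
have p0 : 0 <= level x ^+ n by rewrite exprn_ge0.
have p1 : level x ^+ n <= 1 by rewrite exprn_ile1.
move: (level x ^+ n) p0 p1 => L p0 p1.
by split; [apply: exprn_ge0|apply: exprn_ile1]; rewrite ?subr_ge0 ?gerBl.
Qed.

Let seg_D x : seg x -> D x.
Proof.
rewrite /seg /D /= !in_itv /= => /andP[x1 x2].
by apply/andP; split; [apply: le_trans x1; rewrite lerN2|apply: le_trans x2 _].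
Qed.

(** Both measures give the same integral to each [threshold], and dominated
    convergence applies to both sides. *)
Lemma cdf_semicircle :
  m `]-oo, c[%classic = semicircle (s ^+ 2) `]-oo, c[%classic.
Proof.
pose A : set R := `]-oo, c[%classic.
have mA : measurable A by exact: measurable_itv.
have lim_m : (\int[m]_(x in D) ((threshold n).[x / s])%:E @[n --> \oo] -->
    \int[m]_(x in D) (\1_A x)%:E)%E.
  apply: (dominated_cvg mD (g := cst 1%E)) => //.
  - by move=> n; apply/measurable_EFinP; exact: measurable_horner.
  - by move=> x Dx; apply: cvg_EFin; [exact: nearW | exact: threshold_cvg].
  - exact: finite_measure_integrable_cst.
  - move=> n x Dx; have [q0 q1] := threshold_itv n x Dx.
    by rewrite /= lee_fin ger0_norm.
have lim_sc : (\int[mu]_(x in seg) ((threshold n).[x / s] * sc_density (s ^+ 2) x)%:E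
    @[n --> \oo] --> \int[mu]_(x in seg) (\1_A x * sc_density (s ^+ 2) x)%:E)%E.
  have mseg : measurable seg by exact: measurable_itv.
  apply: (@dominated_cvg _ _ _ mu _ mseg _ _ (EFin \o sc_density (s ^+ 2))) => //.
  - move=> n; apply/measurable_EFinP; apply: measurable_funTS.
    apply: continuous_measurable_fun => x; apply: cvgM.
      exact: continuous_horner_div.
    exact: continuous_sc_density.
  - move=> x /seg_D Dx; apply: cvg_EFin; first exact: nearW.
    by apply: cvgM; [exact: threshold_cvg | exact: cvg_cst].
  - by apply: continuous_itv_integrable; exact: continuous_sc_density.
  - move=> n x /seg_D Dx; have [q0 q1] := threshold_itv n x Dx.
    have d0 : 0 <= sc_density (s ^+ 2) x by apply: sc_density_ge0; rewrite exprn_gt0.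
    by rewrite /= lee_fin normrM !ger0_norm// ler_piMl.
have e n : (\int[m]_(x in D) ((threshold n).[x / s])%:E =
    \int[mu]_(x in seg) ((threshold n).[x / s] * sc_density (s ^+ 2) x)%:E)%E.
  have := congr1 EFin (poly_moments (threshold n)).
  have f1 := integrable_fin_num mD (horner_integrable (threshold n)).
  have f2 : (\int[mu]_(x in seg)
      ((threshold n).[x / s] * sc_density (s ^+ 2) x)%:E)%E \is a fin_num.
    apply: integrable_fin_num; last exact: horner_sc_integrable (threshold n).
    exact: measurable_itv.
  by rewrite /Rintegral !fineK.
have lim_m' : (\int[m]_(x in D) ((threshold n).[x / s])%:E @[n --> \oo] -->
    \int[mu]_(x in seg) (\1_A x * sc_density (s ^+ 2) x)%:E)%E.
  by under eq_fun do rewrite e; exact: lim_sc.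
have mE := cvg_unique (@ereal_hausdorff R) lim_m lim_m'.
rewrite integral_indic// in mE.
have -> : m A = m (A `&` D).
  have mDC : m (~` D) = 0%E.
    by have := @probability_setC _ _ R m D mD; rewrite mD1 subee.
  rewrite -[A in LHS]setIT -(setUv D) setIUr measureU//.
  - rewrite [X in (_ + X)%E](_ : _ = 0%E) ?adde0//.
    by apply: (@subset_measure0 _ _ _ m _ (~` D)) => //; [apply: measurableI|];
      rewrite ?measurableC//; apply: measurableC.
  - exact: measurableI.
  - by apply: measurableI => //; exact: measurableC.
  - by rewrite setIACA setICr setI0.
rewrite mE /semicircle sqrtr_sqr gtr0_norm// integral_mkcondl.
apply: eq_integral => x _; rewrite patchE indicE.
by case: (x \in A); rewrite ?mul1r ?mul0r.
Qed.

End fixed_interval.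

Lemma eq_semicircle_of_moments :
  (exists K0, forall K, K0 <= K -> m `[- K, K]%classic = 1%E /\
    forall n, \int[m]_(x in `[- K, K]) (cheb n.+1).[x / s] = - (n == 1%N)%:R) ->
  forall A, measurable A -> m A = semicircle (s ^+ 2) A.
Proof.
move=> [K0 hK] A mA.
have s2 : 0 < s ^+ 2 by rewrite exprn_gt0.
apply: (@measure_unique _ _ _ (@RGenInftyO.G R) (fun n => `]-oo, n%:R[%classic) _ _ _ _
  m (semicircle_measure _ s2)) => //.
- exact: RGenInftyO.measurableE.
- move=> _ _ [x ->] [y ->]; exists (Num.min x y).
  by apply/seteqP; split => z /=; rewrite !in_itv /= lt_min => /andP.
- by move=> n; exists n%:R.
- apply/seteqP; split => // x _; exists (Num.bound `|x|) => //=.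
  by rewrite in_itv /= (le_lt_trans (ler_norm x))// archi_boundP.
- move=> _ [c ->].
  pose K := Num.max (Num.max K0 `|c|) (Num.max (2 * s) 1).
  have [] := hK K; first by rewrite !le_max lexx.
  move=> mD1 mom; apply: (cdf_semicircle K mD1 mom).
  + by rewrite !lt_max ltr01 !orbT.
  + by rewrite !le_max lexx !orbT.
  + by rewrite !le_max lexx !orbT.
- by move=> n; rewrite (le_lt_trans (probability_le1 _ _)) ?ltry.
Qed.

End semicircle_identification.

(** * The function Psi on the real line *)

Section Psi_real.
Context {R : realType}.
Implicit Types (u w x d : R).
Local Notation normc := (@ComplexField.Normc.normc R).

Lemma sqrtc_real_ge0 x : 0 <= x -> sqrtc (x%:C) = (Num.sqrt x)%:C :> R[i].
Proof. by move=> x0; rewrite sqrtc_sqrtr// ler0c. Qed.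

Lemma sqrtc_real_le0 x : x <= 0 -> sqrtc (x%:C) = Complex 0 (Num.sqrt (- x)).
Proof.
move=> x0; rewrite /sqrtc /= expr0n addr0 sqrtr_sqr eqxx mul1r ler0_norm//.
rewrite addNr mul0r sqrtr0; congr (Complex 0 (Num.sqrt _)); by field.
Qed.

Lemma two_complex : 2 = (2 : R)%:C :> R[i].
Proof. by rewrite rmorph_nat. Qed.

(** The chosen branch of the square root of u^2 - 4 is real outside of
    [-2, 2]. *)
Lemma Psi_of_real_root u d : sqrt_sqrB4 (u%:C) = d%:C ->
  Psi (u%:C) = 4^-1 * (u ^+ 2 - u * d) + ln `|(u + d) / 2| - 2^-1.
Proof.
move=> ud; rewrite /Psi ud; congr (4^-1 * _ + ln _ - _).
  by rewrite -rmorphXn -rmorphM -rmorphB.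
by rewrite two_complex -rmorphD -fmorph_div normc_real.
Qed.

Lemma Psi_segment u : `|u| <= 2 -> Psi (u%:C) = u ^+ 2 / 4 - 2^-1.
Proof.
rewrite ler_norml => /andP[u1 u2].
have S : sqrt_sqrB4 (u%:C) = Complex 0 (Num.sqrt (4 - u ^+ 2)).
  rewrite /sqrt_sqrB4 two_complex -rmorphB -rmorphD.
  rewrite sqrtc_real_le0; last by lra.
  rewrite sqrtc_real_ge0; last by lra.
  rewrite (_ : 4 - u ^+ 2 = (- (u - 2)) * (u + 2)); last by ring.
  rewrite sqrtrM; last by lra.
  by apply/eqP; rewrite eq_complex /=; apply/andP; split; apply/eqP; ring.
rewrite /Psi S.
have -> : complex.Re ((u%:C) ^+ 2 - (u%:C) * Complex 0 (Num.sqrt (4 - u ^+ 2)))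
    = u ^+ 2.
  by rewrite expr2 /=; ring.
have -> : ((u%:C) + Complex 0 (Num.sqrt (4 - u ^+ 2))) / 2 =
    Complex (u / 2) (Num.sqrt (4 - u ^+ 2) / 2).
  rewrite two_complex -fmorphV.
  by apply/eqP; rewrite eq_complex /=; apply/andP; split; apply/eqP; ring.
rewrite normcE_Re_Im /= !expr_div_n sqr_sqrtr; last by nra.
rewrite (_ : u ^+ 2 / 2 ^+ 2 + (4 - u ^+ 2) / 2 ^+ 2 = 1); last by field.
by rewrite sqrtr1 ln1 addr0 mulrC.
Qed.

Lemma joukowski_ge2 w : 0 < w -> 2 <= w + w^-1.
Proof.
move=> w0; rewrite -subr_ge0 (_ : _ - _ = (w - 1) ^+ 2 / w).
  by rewrite divr_ge0 ?sqr_ge0// ltW.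
by field; rewrite gt_eqF.
Qed.

Lemma joukowski_surj u : 2 <= u -> exists2 w, 1 <= w & u = w + w^-1.
Proof.
move=> u2; have d2 : 0 <= u ^+ 2 - 4 by nra.
have := sqr_sqrtr d2; have := sqrtr_ge0 (u ^+ 2 - 4).
move: (Num.sqrt _) => d d0 dE.
exists ((u + d) / 2); first by lra.
have ud : u + d != 0 by rewrite gt_eqF//; lra.
apply: (mulIf ud); rewrite invf_div mulrDl divfK//.
have -> : u * (u + d) = (u + d) / 2 * (u + d) + (u ^+ 2 - d ^+ 2) / 2 by field.
by rewrite dE; field.
Qed.

(** Here the chosen square root is w - 1/w. *)
Lemma Psi_joukowski w : 1 <= w -> Psi ((w + w^-1)%:C) = ln w + w^-1 ^+ 2 / 2.
Proof.
move=> w1; have w0 : 0 < w by lra.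
have w_neq0 : w != 0 by rewrite gt_eqF.
have u2 := joukowski_ge2 w w0.
have wV : 0 <= w - w^-1 by rewrite subr_ge0 (le_trans _ w1)// invf_le1.
rewrite (Psi_of_real_root _ (w - w^-1)).
  rewrite (_ : (w + w^-1 + (w - w^-1)) / 2 = w); last by field.
  by rewrite gtr0_norm//; field.
rewrite /sqrt_sqrB4 two_complex -rmorphB -rmorphD.
rewrite !sqrtc_real_ge0; [|lra|lra].
rewrite -rmorphM -sqrtrM; last by lra.
rewrite (_ : _ * _ = (w - w^-1) ^+ 2); last by field.
by rewrite sqrtr_sqr ger0_norm.
Qed.

(** The other half-line, where both principal square roots are imaginary and
    their product is 1/w - w. *)
Lemma Psi_joukowskiN w : 1 <= w ->
  Psi ((- (w + w^-1))%:C) = ln w + w^-1 ^+ 2 / 2.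
Proof.
move=> w1; have w0 : 0 < w by lra.
have w_neq0 : w != 0 by rewrite gt_eqF.
have u2 := joukowski_ge2 w w0.
have wV : 0 <= w - w^-1 by rewrite subr_ge0 (le_trans _ w1)// invf_le1.
rewrite (Psi_of_real_root _ (- (w - w^-1))).
  rewrite (_ : (- (w + w^-1) + - (w - w^-1)) / 2 = - w); last by field.
  by rewrite normrN gtr0_norm//; field.
rewrite /sqrt_sqrB4 two_complex -rmorphB -rmorphD.
rewrite !sqrtc_real_le0; [|lra|lra].
set a := Num.sqrt _; set b := Num.sqrt _.
have ab : a * b = w - w^-1.
  rewrite /a /b -sqrtrM; last by lra.
  rewrite (_ : _ * _ = (w - w^-1) ^+ 2); last by field.
  by rewrite sqrtr_sqr ger0_norm.
by apply/eqP; rewrite eq_complex /= -ab; apply/andP; split; apply/eqP; ring.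
Qed.

Lemma ln_le_half_sub s : 1 <= s -> ln s <= (s - s^-1) / 2 :> R.
Proof.
move=> s1; pose f (x : R) : R := 2^-1 * (x - x^-1) - ln x.
have deriv x : 0 < x -> is_derive x (1 : R) f (2^-1 * (1 - x^-1) ^+ 2).
  move=> x0; have x_neq0 : x != 0 by rewrite gt_eqF.
  have dln := is_derive1_ln x0.
  have dV : is_derive x (1 : R) (fun x : R => x^-1) (- x ^- 2).
    have := is_deriveV (f := @id R) x_neq0 (is_derive_id x 1) => /is_derive_eq.
    by apply; rewrite /GRing.scale /= mulr1.
  rewrite /f; apply: is_derive_eq; rewrite /GRing.scale /=.
  by field.
have [->|s_neq1] := eqVneq s 1; first by rewrite ln1 invr1 subrr mul0r.
have s_gt1 : 1 < s by rewrite lt_def s_neq1.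
have cont : {within `[1, s], continuous f}.
  apply: derivable_within_continuous => x; rewrite in_itv /= => /andP[x1 _].
  have := deriv x (lt_le_trans ltr01 x1) => h; exact: ex_derive.
have deriv' x : x \in `]1, s[ -> is_derive x (1 : R) f (2^-1 * (1 - x^-1) ^+ 2).
  by rewrite in_itv /= => /andP[x1 _]; exact: deriv (lt_trans ltr01 x1).
have [c] := MVT s_gt1 deriv' cont.
rewrite in_itv /= => /andP[c1 cs].
rewrite /f ln1 invr1 subrr mulr0 !subr0 => e.
have : 0 <= 2^-1 * (1 - c^-1) ^+ 2 * (s - 1).
  by apply: mulr_ge0; [apply: mulr_ge0 => //; exact: sqr_ge0|rewrite subr_ge0].
rewrite -e; lra.
Qed.

(** Outside of [-2, 2], with |u| = w + 1/w, this is the inequality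
    2 ln (w^2) <= w^2 - 1/w^2. *)
Lemma Psi_le_quadratic u : Psi (u%:C) <= u ^+ 2 / 4 - 2^-1.
Proof.
have [u2|u2] := leP `|u| 2; first by rewrite Psi_segment.
have key w : 1 <= w -> ln w + w^-1 ^+ 2 / 2 <= (w + w^-1) ^+ 2 / 4 - 2^-1.
  move=> w1; have w0 : 0 < w by lra.
  have := ln_le_half_sub (w ^+ 2); rewrite exprn_ege1// => /(_ isT).
  rewrite lnXn// -exprVn mulr2n.
  have : w * w^-1 = 1 by rewrite mulfV// gt_eqF.
  move: (ln w) (w^-1) => L v wv.
  rewrite (_ : (w + v) ^+ 2 = w ^+ 2 + v ^+ 2 + 2 * (w * v)); last by ring.
  rewrite wv; lra.
have [w w1 uE] := joukowski_surj _ (ltW u2).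
have [u0|u0] := leP 0 u.
  by rewrite ger0_norm// in uE; rewrite uE Psi_joukowski// key.
rewrite ltr0_norm// in uE.
have -> : u = - (w + w^-1) by rewrite -uE opprK.
by rewrite Psi_joukowskiN// sqrrN key.
Qed.

End Psi_real.

(** * The function U_t on the real line *)

Section potential_on_reals.
Context {R : realType}.
Variables (g : R -> R) (s : R).
Hypothesis s0 : 0 < s.
Implicit Types (x al : R).

Let t : R[i] := (s ^+ 2)%:C.
Let phi (x : R) : R := ln s + x ^+ 2 / (4 * s ^+ 2) - 2^-1.

Lemma f_real al x : 0 < al -> f_ g t al x%:C =
  g al + al * ln (s * Num.sqrt al) + al * Psi ((x / (s * Num.sqrt al))%:C).
Proof.
move=> al0; rewrite /f_ gt_eqF// /t normc_real ger0_norm ?sqr_ge0//.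
rewrite sqrtrM ?sqr_ge0// sqrtr_sqr gtr0_norm//.
rewrite -rmorphM sqrtc_real_ge0 ?mulr_ge0 ?sqr_ge0 ?(ltW al0) ?(ltW s0)//.
rewrite sqrtrM ?sqr_ge0// sqrtr_sqr gtr0_norm//.
by rewrite -fmorph_div.
Qed.

Let ln_ssqrt al : 0 < al -> ln (s * Num.sqrt al) = ln s + ln al / 2.
Proof.
by move=> al0; rewrite lnM ?posrE ?sqrtr_gt0// ln_sqrt// [_^-1 * _]mulrC.
Qed.

Let sqr_ssqrt al x : 0 < al ->
  al * ((x / (s * Num.sqrt al)) ^+ 2 / 4) = x ^+ 2 / (4 * s ^+ 2).
Proof.
move=> al0; rewrite expr_div_n exprMn sqr_sqrtr ?ltW//.
by field; rewrite !gt_eqF.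
Qed.

(** The coefficient of x^2 does not depend on al: comparing these bounds for
    different al only involves their values at x = 0. *)
Lemma f_le_quadratic al x : 0 < al -> f_ g t al x%:C <=
  g al + al * (ln s + ln al / 2) + x ^+ 2 / (4 * s ^+ 2) - al / 2.
Proof.
move=> al0; rewrite f_real// ln_ssqrt// -(sqr_ssqrt al)//.
have := ler_wpM2l (ltW al0) (Psi_le_quadratic (x / (s * Num.sqrt al))).
rewrite mulrBr; lra.
Qed.

Lemma f_eq_quadratic al x : 0 < al -> `|x| <= 2 * (s * Num.sqrt al) ->
  f_ g t al x%:C =
  g al + al * (ln s + ln al / 2) + x ^+ 2 / (4 * s ^+ 2) - al / 2.
Proof.
move=> al0 xal; rewrite f_real// ln_ssqrt// -(sqr_ssqrt al)//.
have p0 : 0 < s * Num.sqrt al by rewrite mulr_gt0// sqrtr_gt0.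
rewrite Psi_segment; first by rewrite mulrBr; lra.
by rewrite normrM normfV [`|s * _|]gtr0_norm// ler_pdivrMr.
Qed.

Lemma f1_segment x : `|x| <= 2 * s -> f_ g t 1 x%:C = g 1 + phi x.
Proof.
by move=> xs; rewrite f_eq_quadratic ?sqrtr1 ?mulr1// ln1 /phi; lra.
Qed.

Let U_ge al x : 0 <= al -> al <= 1 ->
  ((f_ g t al x%:C - g 1)%:E <= U_ g t x%:C)%E.
Proof.
move=> al0 al1; rewrite /U_ EFinB leeB//; apply: ereal_sup_ubound.
by exists al => //=; rewrite in_itv /= al0.
Qed.

Lemma U_ge_phi x : `|x| <= 2 * s -> ((phi x)%:E <= U_ g t x%:C)%E.
Proof.
move=> xs; have := U_ge 1 x ler01 (lexx _).
by rewrite f1_segment// addrAC subrr add0r.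
Qed.

Let U_eq x : (forall al, 0 <= al -> al <= 1 -> f_ g t al x%:C <= f_ g t 1 x%:C) ->
  U_ g t x%:C = (f_ g t 1 x%:C - g 1)%:E.
Proof.
move=> le1; apply/eqP; rewrite eq_le U_ge// andbT /U_ EFinB leeB//.
apply: ub_ereal_sup => _ [al al01 <-].
move: al01; rewrite /= in_itv /= => /andP[al0 al1].
by rewrite lee_fin le1.
Qed.

(** An al that makes the exponential in t_Wig larger than t makes f_t(al, .)
    larger than f_t(1, .) at 0, hence by a constant where both are given by their
    quadratic forms. *)
Lemma t_Wig_gt : ((s ^+ 2)%:E < t_Wig g)%E -> exists r e : R,
  [/\ 0 < r, 0 < e & forall x, `|x| <= r -> ((phi x + e)%:E <= U_ g t x%:C)%E].
Proof.
move=> /ereal_sup_gt [_ [al al01 <-]].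
move: al01; rewrite /= in_itv /= => /andP[al0 al1].
have al1' : 0 < 1 - al by rewrite subr_gt0.
rewrite lte_fin -ltr_ln ?posrE ?expR_gt0 ?exprn_gt0// expRK lnXn//.
rewrite -(ltr_pM2r al1').
have -> : (2 * ((g al - g 1) / (1 - al)) + al / (1 - al) * ln al + 1) * (1 - al)
    = 2 * (g al - g 1) + al * ln al + (1 - al) by field; rewrite gt_eqF.
rewrite -(mulr_natl (ln s)) => h.
exists (2 * (s * Num.sqrt al)),
  (g al + al * (ln s + ln al / 2) - al / 2 - g 1 - (ln s - 2^-1)); split.
- by rewrite !mulr_gt0// sqrtr_gt0.
- lra.
move=> x xr; apply: le_trans (U_ge al x (ltW al0) (ltW al1)).
by rewrite lee_fin f_eq_quadratic// /phi; lra.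
Qed.

(** The inequality t_Wig <= t says that the quadratic bounds of f_t(al, .) for al
    in ]0, 1[ are below the one for al = 1, which is attained on the segment. *)
Lemma U_segment : {within `[0, 1], continuous g} -> (t_Wig g <= (s ^+ 2)%:E)%E ->
  forall x, `|x| <= 2 * s -> U_ g t x%:C = (phi x)%:E.
Proof.
move=> cg tW x xs; rewrite U_eq f1_segment//; first by rewrite addrAC subrr add0r.
have W al : 0 < al -> al < 1 ->
    g al <= g 1 + (1 - al) * (ln s - 2^-1) - al * ln al / 2.
  move=> al0 al1.
  have : ((expR (2 * ((g al - g 1) / (1 - al)) + al / (1 - al) * ln al + 1))%:E
      <= (s ^+ 2)%:E)%E.
    apply: le_trans tW; apply: ereal_sup_ubound; exists al => //=.
    by rewrite in_itv /= al0.
  rewrite lee_fin => h.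
  rewrite -ler_ln ?posrE ?expR_gt0 ?exprn_gt0// expRK lnXn// in h.
  have al1' : 0 < 1 - al by rewrite subr_gt0.
  have := ler_wpM2r (ltW al1') h.
  have -> : (2 * ((g al - g 1) / (1 - al)) + al / (1 - al) * ln al + 1) * (1 - al)
    = 2 * (g al - g 1) + al * ln al + (1 - al) by field; rewrite gt_eqF.
  rewrite -(mulr_natl (ln s)); lra.
(* al = 0 is the limit of al > 0: the term al ln al vanishes there. *)
have W0 : g 0 <= g 1 + (ln s - 2^-1).
  have lnV al : 0 < al -> - (al * ln al / 2) <= Num.sqrt al.
    move=> al0; have q0 : 0 < Num.sqrt al by rewrite sqrtr_gt0.
    have := expR_ge1Dx (ln (Num.sqrt al)^-1); rewrite lnK ?posrE ?invr_gt0//.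
    rewrite lnV ?posrE//; have : al = Num.sqrt al ^+ 2 by rewrite sqr_sqrtr// ltW.
    move: q0; move: (Num.sqrt al) => q q0 ->; rewrite lnXn// mulr2n => h.
    have : q * q^-1 = 1 by rewrite mulfV// gt_eqF.
    move: h; move: (ln q) (q^-1) => L v h qv.
    have := ler_wpM2l (ltW (exprn_gt0 2 q0)) h.
    have : q ^+ 2 * v = q by rewrite expr2 -mulrA qv mulr1.
    nra.
  pose G al := g al - (1 - al) * (ln s - 2^-1) - Num.sqrt al.
  have [_ g0 _] := (continuous_within_itvP g ltr01).1 cg.
  have limG : G al @[al --> 0^'+] --> g 0 - (1 - 0) * (ln s - 2^-1) - Num.sqrt 0.
    apply: cvgB; last by apply: cvg_at_right_filter; exact: sqrt_continuous.
    apply: cvgB; first exact: g0.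
    apply: cvgM; last exact: cvg_cst.
    by apply: cvg_at_right_filter; apply: cvgB; [exact: cvg_cst|exact: cvg_id].
  have : lim (G al @[al --> 0^'+]) <= g 1.
    apply: limr_le; first by apply/cvg_ex; eexists; exact: limG.
    near=> al; have al0 : 0 < al by [].
    have al1 : al < 1 by near: al; exact: nbhs_right_lt.
    by have := W al al0 al1; have := lnV al al0; rewrite /G; lra.
  rewrite (cvg_lim _ limG)// sqrtr0; lra.
move=> al; rewrite le_eqVlt => /predU1P[<- _|al0].
  rewrite /f_ eqxx /phi; apply: le_trans W0 _.
  have : 0 <= x ^+ 2 / (4 * s ^+ 2) 
    by apply: divr_ge0; [exact: sqr_ge0|apply: mulr_ge0 => //; exact: sqr_ge0].
  lra.
rewrite le_eqVlt => /predU1P[->|al1]; first by rewrite f1_segment.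
apply: le_trans (f_le_quadratic _ _ al0) _.
by have := W al al0 al1; rewrite /phi; nra.
Unshelve. all: by end_near. Qed.


(** Near 1 the difference quotient is bounded below because its limit is not
    -oo; away from 1 the continuous g is bounded. *)
Lemma slope_bound : {within `[0, 1], continuous g} ->
  (exists2 l : \bar R, ((g x - g 1) / (x - 1))%:E @[x --> 1^'-] --> l & (-oo < l)%E) ->
  exists M : R, forall al, 0 <= al -> al <= 1 -> g al - g 1 <= M * (1 - al).
Proof.
move=> cg [l gl l_gt].
have [m ml] : exists m : R, (m%:E < l)%E.
  case: l l_gt {gl} => [l _| _|//]; last by exists 0; rewrite ltry.
  by exists (l - 1); rewrite lte_fin; lra.
have : \forall x \near 1^'-, (m%:E < ((g x - g 1) / (x - 1))%:E)%E.
  exact: gl (open_ereal_gt' ml).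
move=> [/= d d0 hd].
have [c _ gc] := EVT_max (ler01 : (0 : R) <= 1) cg.
pose M := Num.max (- m) (Num.max 0 (g c - g 1) / d).
exists M => al al0 al1.
have [->|al_neq1] := eqVneq al 1; first by rewrite !subrr mulr0.
have al_lt1 : 0 < 1 - al by rewrite subr_gt0 lt_neqAle al_neq1.
have [near1|far1] := ltP (1 - al) d.
  have := hd al; rewrite /= ger0_norm ?(ltW al_lt1)// => /(_ near1).
  rewrite -subr_gt0 => /(_ al_lt1); rewrite lte_fin => h.
  apply: (@le_trans _ _ (- m * (1 - al))).
    have : (g al - g 1) / (al - 1) * (1 - al) = - (g al - g 1).
      by field; rewrite subr_eq0.
    move: h; move: ((g al - g 1) / (al - 1)) => q h; nra.
  by rewrite ler_pM2r// /M le_max lexx.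
have gal : g al <= g c by apply: gc; rewrite in_itv /= al0.
set P := Num.max 0 (g c - g 1).
have P0 : 0 <= P by rewrite le_max lexx.
apply: (@le_trans _ _ P); first by rewrite le_max; apply/orP; right; lra.
apply: (@le_trans _ _ (P / d * (1 - al))).
  rewrite mulrAC ler_pdivlMr//; exact: ler_wpM2l.
by rewrite ler_pM2r// /M le_max lexx orbT.
Qed.

(** The point s (v + al / v) is 2 s sqrt al times a point (w + 1/w) / 2, for
    w = v / sqrt al >= 1. *)
Let f_joukowski al v : 0 < al -> 0 < v -> al <= v ^+ 2 ->
  f_ g t al (s * (v + al / v))%:C =
  g al + al * (ln s + ln v) + (al / v) ^+ 2 / 2.
Proof.
move=> al0 v0 alv; set q := Num.sqrt al.
have q0 : 0 < q by rewrite sqrtr_gt0.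
have alE : al = q ^+ 2 by rewrite sqr_sqrtr// ltW.
have qv : q <= v by rewrite /q -[leRHS](gtr0_norm v0) -sqrtr_sqr ler_sqrt ?sqr_ge0.
rewrite f_real// -/q.
have -> : s * (v + al / v) / (s * q) = v / q + (v / q)^-1.
  by rewrite alE; field; rewrite !gt_eqF.
rewrite Psi_joukowski; last by rewrite ler_pdivlMr// mul1r.
rewrite lnM ?posrE// ln_div ?posrE//.
have -> : (al / v) ^+ 2 = al * (v / q)^-1 ^+ 2.
  by rewrite alE; field; rewrite !gt_eqF.
ring.
Qed.

(** Far from the origin the supremum is reached at al = 1: f_t(al, x) is there a
    concave function of al, up to the term g(al), whose slope at al = 1 is the
    logarithm of s / r and thus exceeds the slope bound M of g. *)
Lemma U_outside (M : R) :
  (forall al, 0 <= al -> al <= 1 -> g al - g 1 <= M * (1 - al)) ->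
  exists2 r0, 0 < r0 & forall r, 0 < r -> r <= r0 ->
    U_ g t (s * (r^-1 + r))%:C = (ln s - ln r + r ^+ 2 / 2)%:E.
Proof.
move=> slope.
(* The bound 1/2 is used for r b <= 1/2 below, the other one for M <= ln (s / r). *)
exists (Num.min 2^-1 (s / expR M)).
  by rewrite lt_min invr_gt0 ltr0Sn divr_gt0// expR_gt0.
move=> r r_gt0; rewrite le_min => /andP[r2 rM].
set w := r^-1; have w0 : 0 < w by rewrite invr_gt0.
have rw : r = 1 / w by rewrite /w div1r invrK.
have w2 : 2 <= w.
  by rewrite /w -[leLHS]invrK lef_pV2// ?posrE ?invr_gt0.
have Mw : M <= ln s + ln w.
  rewrite -lnM ?posrE// -[leLHS]expRK ler_ln ?posrE ?expR_gt0 ?mulr_gt0//.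
  by rewrite /w ler_pdivlMr// mulrC -ler_pdivlMr ?expR_gt0.
have f1 : f_ g t 1 (s * (w + r))%:C = g 1 + (ln s + ln w) + r ^+ 2 / 2.
  by rewrite {1}rw f_joukowski// ?mul1r -?rw//; nra.
rewrite U_eq; last first.
  move=> al; rewrite le_eqVlt => /predU1P[<- _|al0].
    rewrite f1 /f_ eqxx; have := slope 0 (lexx _) ler01.
    have := sqr_ge0 r; lra.
  rewrite le_eqVlt => /predU1P[->//|al1]; rewrite f1.
  set q := Num.sqrt al; have q0 : 0 < q by rewrite sqrtr_gt0.
  have alE : al = q ^+ 2 by rewrite sqr_sqrtr// ltW.
  have q1 : q < 1 by rewrite ltNge; apply/negP => q1; move: al1; rewrite alE; nra.
  have [|w' w'1 w'E] := joukowski_surj ((w + r) / q).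
    by rewrite ler_pdivlMr//; nra.
  have w'0 : 0 < w' by lra.
  pose v := q * w'; have v0 : 0 < v by rewrite mulr_gt0.
  have alv : al <= v ^+ 2 by rewrite alE /v exprMn ler_peMr ?sqr_ge0// exprn_ege1.
  have vE : w + r = v + al / v.
    have : w + r = q * (w' + w'^-1) by rewrite -w'E mulrC divfK// gt_eqF.
    by move=> ->; rewrite alE /v; field; rewrite !gt_eqF.
  rewrite vE f_joukowski//; move: (slope al (ltW al0) (ltW al1)) => sl.
  set b := al / v in vE *.
  have bE : v * b = al by rewrite /b mulrC divfK// gt_eqF.
  have b0 : 0 < b by rewrite divr_gt0.
  have b1 : b <= 1.
    rewrite /b ler_pdivrMr// mul1r /v alE expr2 ler_pM2l//; lra.
  have wr : w * r = 1 by rewrite /w mulVf// gt_eqF.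
  (* Both representations of x, w + 1/w and v + al / v, with r = 1/w and
     b = al / v, are combined so as to eliminate w and v. *)
  have step : r * (1 - al) = (r - b) * (1 - r * b).
    have -> : al = (w + r - b) * b by rewrite -bE; congr (_ * b); rewrite vE addrK.
    rewrite (_ : r * (1 - (w + r - b) * b) =
      r - (w * r) * b - r * b * (r - b)); last by ring.
    by rewrite wr; ring.
  have br : b < r.
    rewrite -subr_gt0 -(pmulr_lgt0 _ (_ : 0 < 1 - r * b)); last by nra.
    by rewrite -step mulr_gt0// subr_gt0.
  have lnvw : ln v - ln w <= (r - b) * r.
    rewrite -ln_div ?posrE//; have := expR_ge1Dx (ln (v / w)).
    rewrite lnK ?posrE ?divr_gt0//.
    have -> : v / w = 1 + (r - b) * r.
      have -> : v = w + r - b by rewrite vE addrK.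
      rewrite -/w -[w^-1]mul1r -rw.
      rewrite (_ : (w + r - b) * r = w * r + (r - b) * r); last by ring.
      by rewrite wr.
    lra.
  have h1 : al * (ln v - ln w) <= al * ((r - b) * r).
    by apply: ler_wpM2l lnvw; exact: ltW.
  have h2 : M * (1 - al) <= (ln s + ln w) * (1 - al).
    by apply: ler_wpM2r => //; rewrite subr_ge0 ltW.
  have h3 : 2 * (al * ((r - b) * r)) <= r ^+ 2 - b ^+ 2.
    have -> : 2 * (al * ((r - b) * r)) = 2 * (r - b) * (r - r * (1 - al)) by ring.
    rewrite step -subr_ge0.
    rewrite (_ : _ - _ = (r - b) * ((r - b) * (1 - 2 * (r * b)))); last by ring.
    apply: mulr_ge0; first by rewrite subr_ge0 ltW.
    apply: mulr_ge0; first by rewrite subr_ge0 ltW.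
    nra.
  lra.
rewrite f1 /w lnV ?posrE//; congr (_%:E); lra.
Qed.

End potential_on_reals.

(** * Measures on the real line with the potential of the semicircle law *)

HB.instance Definition _ (R : realType) :=
  isMeasurableFun.Build _ _ _ _ (@complex.Re R) (@measurable_Re R).

Section semicircle_on_the_line.
Context {R : realType}.
Local Notation normc := (@ComplexField.Normc.normc R).
Variables (nu : probability R[i] R) (s k r0 : R).
Hypotheses (s0 : 0 < s) (nuk : nu [set y | k < normc y] = 0%E)
  (nu_real : nu [set y | complex.Im y != 0] = 0%E)
  (r0_gt0 : 0 < r0)
  (pot : forall r, 0 < r -> r <= r0 ->
    (\int[nu]_y lne (normc ((s * (r^-1 + r))%:C - y))%:E =
     (ln s - ln r + r ^+ 2 / 2)%:E)%E).

Let m : probability R R := distribution nu (@complex.Re R).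

Let Re_le_ball K : k <= K -> m `[- K, K]%classic = 1%E.
Proof.
move=> kK; have mD : measurable `[- K, K]%classic by exact: measurable_itv.
have mDC : m (~` `[- K, K]%classic) = 0%E.
  apply: (@subset_measure0 _ _ _ nu _ [set y | k < normc y]) => //.
  - by rewrite -[X in measurable X]setTI; apply: measurable_Re => //;
      exact: measurableC.
  - exact: measurable_normc_gt.
  move=> y /= yK; rewrite ltNge; apply/negP => yk; apply: yK.
  by rewrite in_itv /= -ler_norml (le_trans (Re_le_normc y))// (le_trans yk).
have := @probability_setC _ _ R m _ (measurableC mD); rewrite setCK => ->.
by rewrite mDC sube0.
Qed.

(** For y real, |s (1/r + r) - y| = (s / r) (1 - (y / s) r + r^2). *)
Let log_moments K : k <= K -> 0 <= K ->
  exists2 r1, 0 < r1 & forall r, 0 < r -> r <= r1 ->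
    \int[m]_(x in `[- K, K]) ln (1 - x / s * r + r ^+ 2) = r ^+ 2 / 2.
Proof.
move=> kK K0; have B0 : 0 <= K / s by rewrite divr_ge0// ltW.
exists (Num.min r0 (2 * (K / s + 1))^-1).
  by rewrite lt_min r0_gt0 invr_gt0 mulr_gt0//; lra.
move=> r r_gt0; rewrite le_min => /andP[rr0 rK].
have B1 : 0 < 2 * (K / s + 1) by rewrite mulr_gt0//; lra.
have {}rK : r * (2 * (K / s + 1)) <= 1.
  by rewrite -ler_pdivlMr// mul1r.
pose D : set R := `[- K, K]%classic.
have mD : measurable D by exact: measurable_itv.
pose F (x : R) := ln (1 - x / s * r + r ^+ 2).
have mF : measurable_fun setT F.
  apply: (measurableT_comp (@measurable_ln R)).
  apply: continuous_measurable_fun => x; apply: cvgD; last exact: cvg_cst.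
  apply: cvgB; first exact: cvg_cst.
  by do 2! (apply: cvgM; last exact: cvg_cst); exact: cvg_id.
have iF : m.-integrable D (EFin \o F).
  have := log_tail_integrable m s K s0 0 r (ltW r_gt0) rK.
  apply: eq_integrable => // x _ /=.
  by rewrite /log_tail big_ord0 addr0.
pose G (x : R) : \bar R := (ln s - ln r + F x)%:E.
have iG : m.-integrable D G.
  rewrite /G; under eq_fun do rewrite EFinD.
  apply: integrableD => //; exact: finite_measure_integrable_cst.
have mG : measurable_fun setT (G \_ D).
  apply/(measurable_restrictT _ mD); apply: measurable_funTS.
  by apply/measurable_EFinP; apply: measurable_funD.
have iGD : m.-integrable setT (G \_ D).
  by apply/integrable_restrict => //; rewrite setTI.
have := pot r r_gt0 rr0.
rewrite (ae_eq_integral ((G \_ D) \o @complex.Re R)) //; last 3 first.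
- exact: measurable_lne_normc.
- exact: measurableT_comp mG (@measurable_Re R).
- have : nu.-negligible ([set y | k < normc y] `|` [set y | complex.Im y != 0]).
    apply: negligibleU; apply/negligibleP => //.
      exact: measurable_normc_gt.
    exact: measurable_Im_neq0.
  apply: negligibleS => y /= h; apply: contrapT => hy; apply: h => _.
  have Im0 : complex.Im y = 0.
    by apply/eqP/negPn/negP => Im0; apply: hy; right.
  have yk : normc y <= k.
    by rewrite leNgt; apply/negP => yk; apply: hy; left.
  have yK : `|complex.Re y| <= K by rewrite (le_trans (Re_le_normc y))// (le_trans yk).
  have yD : complex.Re y \in D by rewrite inE /D /= in_itv /= -ler_norml.
  rewrite patchE yD /G /F normc_dist_xy Im0 /dist_xy expr0n addr0 sqrtr_sqr.
  move: (complex.Re y) yK => a aK.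
  have aB : `|a / s| <= K / s.
    by rewrite normrM normfV [`|s|]gtr0_norm// ler_pM2r ?invr_gt0.
  have pos : 0 < 1 - a / s * r + r ^+ 2.
    move: aB; rewrite ler_norml => /andP[_ a2]; have := sqr_ge0 r; nra.
  have -> : s * (r^-1 + r) - a = s / r * (1 - a / s * r + r ^+ 2).
    by field; rewrite !gt_eqF.
  have pos' : 0 < s / r * (1 - a / s * r + r ^+ 2) by rewrite mulr_gt0// divr_gt0.
  rewrite gtr0_norm// leNgt pos' /=.
  by rewrite lnM ?posrE ?mulr_gt0 ?invr_gt0// ln_div ?posrE.
rewrite -(@integral_distribution _ _ _ _ _ nu (@complex.Re R)) //; last first.
  apply/integrableP; split; first exact: measurableT_comp mG (@measurable_Re R).
  have mabs : measurable_fun setT (fun x => `|(G \_ D) x|)%E.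
    exact: measurableT_comp mG.
  have := @ge0_integral_distribution _ _ _ _ _ nu (@complex.Re R) _ mabs
    (fun x => abse_ge0 _).
  by rewrite /comp => <-; have /integrableP[] := iGD.
rewrite -/m -integral_mkcond.
have fF : (\int[m]_(x in D) (F x)%:E)%E \is a fin_num by exact: integrable_fin_num.
have -> : (\int[m]_(x in D) G x = (ln s - ln r + \int[m]_(x in D) F x)%:E)%E.
  rewrite /G; under eq_integral do rewrite EFinD.
  rewrite integralD//; last exact: finite_measure_integrable_cst.
  rewrite integral_cst// [X in (_ * X)%E](_ : _ = 1%E) ?mule1; last exact: Re_le_ball.
  by rewrite [RHS]EFinD /Rintegral fineK.
by case => /addrI.
Qed.

(** The Chebyshev moments of the law of the real part are read off from the
    potential; they are those of the semicircle law. *)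
Lemma eq_semicircle : forall A, measurable A ->
  nu A = pushforward (semicircle (s ^+ 2)) (real_complex R) A.
Proof.
move=> A mA; pose B : set R := real_complex R @^-1` A.
have mB : measurable B.
  by rewrite -[B]setTI; apply: measurable_real_complex.
have mA' : measurable ((@complex.Re R) @^-1` B).
  by rewrite -[X in measurable X]setTI; apply: measurable_Re.
have -> : nu A = m B.
  have mN := @measurable_Im_neq0 R.
  have e1 := measureU0 (mu := nu) mA mN nu_real.
  have e2 := measureU0 (mu := nu) mA' mN nu_real.
  move: e1; rewrite (_ : A `|` _ = (@complex.Re R) @^-1` B `|`
    [set y | complex.Im y != 0]) => [e1|]; first exact: etrans (esym e1) e2.
  apply/seteqP; split => -[a b] /= [h|h]; try (by right);
    by have [b0|b0] := eqVneq b 0; [left; move: h; rewrite /B /= b0|right].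
rewrite /pushforward; apply: (eq_semicircle_of_moments m s s0) => //.
exists (Num.max k 0) => K; rewrite ge_max => /andP[kK K0].
split; first exact: Re_le_ball.
have [r1 r1_gt0 hr1] := log_moments K kK K0.
exact: (cheb_moments m s K s0 r1 r1_gt0 K0 hr1).
Qed.

End semicircle_on_the_line.

Section semicircle_law.
Context {R : realType}.
Local Notation normc := (@ComplexField.Normc.normc R).

Lemma semicircle_segment (nu : probability R[i] R) (s : R) : 0 < s ->
  (forall A : set R[i], measurable A ->
     nu A = pushforward (semicircle (s ^+ 2)) (real_complex R) A) ->
  nu.-negligible (~` [set y | complex.Im y = 0 /\ `|complex.Re y| <= 2 * s]).
Proof.
move=> s0 nuE.
set S := [set y : R[i] | _].
have mS : measurable S.
  rewrite (_ : S = ~` [set y | complex.Im y != 0] `&`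
      (@complex.Re R) @^-1` `[- (2 * s), 2 * s]%classic).
    apply: measurableI; first by apply: measurableC; exact: measurable_Im_neq0.
    by rewrite -[X in measurable X]setTI; apply: measurable_Re.
  apply/seteqP; split => y; rewrite /S /= in_itv /= -ler_norml => -[h1 h2].
    by split=> //; rewrite h1 eqxx.
  by split=> //; apply/eqP/negPn/negP.
apply/negligibleP; first exact: measurableC.
apply: etrans (nuE _ (measurableC mS)) _.
rewrite /pushforward /semicircle (_ : _ `&` _ = set0) ?integral_set0//.
apply/seteqP; split => // x [] /= h; rewrite sqrtr_sqr gtr0_norm// in_itv /=.
by rewrite -ler_norml => xs; apply: h.
Qed.

End semicircle_law.

(** * The Wigner threshold *)

Theorem theorem2p12 (R : realType) (d : measure_display)
    (T : measurableType d) (P : probability T R) (xi : nat -> {RV P >-> R[i]})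
    (a : nat -> nat -> R[i]) (g : R -> R) (t : R) (nu : probability R[i] R) :
  0 < t ->
  condition_A1 xi ->
  condition_A2 a g ->
  is_nu xi a g t%:C nu ->
  ((forall A : set R[i], measurable A ->
      nu A = pushforward (semicircle t) (real_complex R) A)
   <-> (t_Wig g <= t%:E)%E)
  /\ ((t%:E < t_Wig g)%E -> nu [set z | complex.Im z = 0] <> 1%E).
Proof.
move=> t0 _ [cg _ _ slope] [_ [K cK nuK] pot].
have [s s0 tE] : exists2 s : R, 0 < s & t = s ^+ 2.
  by exists (Num.sqrt t); rewrite ?sqrtr_gt0// sqr_sqrtr// ltW.
rewrite {}tE {t0} in pot *.
have [k hk] := compact_normc_bounded K cK.
have nuk : nu [set y | k < ComplexField.Normc.normc y] = 0%E.
  have mK : measurable (~` K).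
    apply: sub_sigma_algebra; apply: closed_openC.
    exact: compact_closed (@norm_hausdorff _ R[i]) cK.
  apply: (subset_measure0 _ mK) => //; first exact: measurable_normc_gt.
  by move=> y /= ky Ky; move: ky; rewrite ltNge hk.
pose c := 4 * s + `|k| + 1.
have c0 : 0 <= c by rewrite !addr_ge0// mulr_ge0// ltW.
have ck : 4 * s + k + 1 <= expR c.
  have := expR_ge1Dx c; have := ler_norm k; rewrite /c; lra.
have [M hM] := slope_bound g cg slope.
have [r0 r0_gt0 outside] := U_outside g s s0 M hM.
have identify : nu [set y | complex.Im y != 0] = 0%E -> forall A, measurable A ->
    nu A = pushforward (semicircle (s ^+ 2)) (real_complex R) A.
  move=> nu_real; apply: (eq_semicircle nu s k r0 s0 nuk nu_real r0_gt0).
  by move=> r r1 r2; rewrite pot outside.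
have above : ((s ^+ 2)%:E < t_Wig g)%E ->
    ~ (forall A : set R[i], measurable A ->
      nu A = pushforward (semicircle (s ^+ 2)) (real_complex R) A).
  move=> tW nuE.
  have [r [e [r_gt0 e0 Ue]]] := t_Wig_gt g s s0 tW.
  apply: (segment_potential_not_above nu s k c s0 c0 nuk ck r e r_gt0 e0).
  - exact: semicircle_segment.
  - by move=> x xs; rewrite pot; exact: U_ge_phi.
  - by move=> x _ xr; rewrite pot; exact: Ue.
split; first split.
- by move=> nuE; rewrite leNgt; apply/negP => /above; exact.
- move=> tW; apply: identify.
  apply: (potential_concentrated_on_reals nu s k c s0 c0 nuk ck) => x xs.
  by rewrite pot; exact: U_segment.
move=> tW nu1; apply: (above tW); apply: identify.
have := @probability_setC _ _ R nu _ (measurableC (@measurable_Im_neq0 R)).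
rewrite setCK => ->; rewrite (_ : ~` _ = [set z | complex.Im z = 0]).
  by rewrite nu1 subee.
by apply/seteqP; split => y /=; [move=> /negP/negPn/eqP|move=> ->; rewrite eqxx].
Qed.
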